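(* Let $(\mathbb P,\mathbb Q)$ be an admissible pair of shift-invariant probability measures on $\Omega$. Then the following hold. (i) The sequence $(\tfrac1n\ln W_n)_{n\in\mathbb N}$ satisfies the LDP with respect to $\mathbb P\otimes\mathbb Q$ with the convex rate function $I_W$ given by $$I_W(s)=\begin{cases}\infty&\text{if }s<0,\\ \inf_{r\ge s}\,(r-s+I_{\mathbb Q}(r))&\text{if }s\ge0.\end{cases}$$ (ii) For all $\alpha\in\mathbb R$, the limit $$q_W(\alpha):=\lim_{n\to\infty}\frac1n\ln\iint e^{\alpha\ln W_n(x,y)}\,d\mathbb P(x)\,d\mathbb Q(y)$$ exists in $(-\infty,\infty]$, one has $$q_W(\alpha)=\max\{q_{\mathbb Q}(\alpha),q_{\mathbb Q}(-1)\},$$ and the Legendre–Fenchel duality relations $q_W=I_W^*$ and $I_W=q_W^*$ hold. (iii) If $\mathbb Q=\mathbb P$, then $I_W$ is a good rate function and $(\tfrac1n\ln W_n)_{n\in\mathbb N}$ is an exponentially tight family of random variables.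
   Context: Setting. $\mathbb N=\{1,2,\dots\}$, $\mathcal A$ is a finite alphabet, $\Omega=\mathcal A^{\mathbb N}$ with the product topology and Borel $\sigma$-algebra, $T:\Omega\to\Omega$, $(Tx)_n=x_{n+1}$. For $x\in\Omega$, $x_k^n$ is the word $x_kx_{k+1}\cdots x_n$. For $u\in\mathcal A^n$, $[u]=\{x\in\Omega:x_1^n=u\}$. $\mathcal A^0$ contains only the empty word. $\mathcal P_{\mathrm{inv}}(\Omega)$ is the set of shift-invariant Borel probability measures. For $\mathbb P\in\mathcal P_{\mathrm{inv}}(\Omega)$: $\mathbb P_n(u)=\mathbb P([u])$ for $u\in\mathcal A^n$, $\operatorname{supp}\mathbb P_n=\{u\in\mathcal A^n:\mathbb P_n(u)>0\}$. $\mathbb P_n\ll\mathbb Q_n$ means absolute continuity. Waiting times: $W_n(x,y)=\inf\{k\in\mathbb N:y_k^{k+n-1}=x_1^n\}$ for $x,y\in\Omega$ (it is $(\mathbb P\otimes\mathbb Q)$-a.s. finite under the hypotheses of the theorem). Decoupling. Fix sequences $(\tau_n)_{n\in\mathbb N}$ in $\mathbb N\cup\{0\}$ and $(C_n)_{n\in\mathbb N}$ in $[1,\infty)$ with $\lim_n\tau_n/n=\lim_n(\ln C_n)/n=0$. - $\mathbb P\in\mathcal P_{\mathrm{inv}}(\Omega)$ satisfies UD if for all $n,m\in\mathbb N$, $u\in\mathcal A^n$, $v\in\mathcal A^m$, $\xi\in\mathcal A^{\tau_n}$: $\mathbb P_{n+\tau_n+m}(u\xi v)\le C_n\mathbb P_n(u)\mathbb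 P_m(v)$. - A pair $(\mathbb P,\mathbb Q)$ in $\mathcal P_{\mathrm{inv}}(\Omega)$ satisfies JSLD if for all $n,m\in\mathbb N$, $u\in\mathcal A^n$, $v\in\mathcal A^m$ there exist $0\le\ell\le\tau_n$ and $\xi\in\mathcal A^\ell$ such that both $\mathbb P_{n+\ell+m}(u\xi v)\ge C_n^{-1}\mathbb P_n(u)\mathbb P_m(v)$ and $\mathbb Q_{n+\ell+m}(u\xi v)\ge C_n^{-1}\mathbb Q_n(u)\mathbb Q_m(v)$. - $(\mathbb P,\mathbb Q)$ is admissible if $\mathbb P_n\ll\mathbb Q_n$ for all $n$, $\mathbb P$ and $\mathbb Q$ both satisfy UD, and $(\mathbb P,\mathbb Q)$ satisfies JSLD. Large deviations. A sequence $(Z_n)$ of a.s. finite real random variables on a probability space with measure $\mathbb P_*$ satisfies the LDP with rate function $I$ if $I:\mathbb R\to[0,\infty]$ is lower semicontinuous, $\liminf_n\frac1n\ln\mathbb P_*\{Z_n\in O\}\ge-\inf_OI$ for every open $O\subseteq\mathbb R$, and $\limsup_n\frac1n\ln\mathbb P_*\{Z_n\in\Gamma\}\le-\inf_\Gamma I$ for every closed $\Gamma\subseteq\mathbb R$. $I$ is good if $I(s)\to\infty$ as $s\to\pm\infty$. $(Z_n)$ is exponentially tight if for every $\beta\in\mathbb R$ there is $M>0$ with $\mathbb P_*\{Z_n\notin[-M,M]\}\le e^{-\beta n}$ for all large $n$. $f^*(\alpha)=\sup_{s\in\mathbb R}(\alpha s-f(s))$. The functions $I_{\mathbb Q}$ and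 $q_{\mathbb Q}$. For an admissible pair, it is known that the random variables $x\mapsto-\frac1n\ln\mathbb Q_n(x_1^n)$ on $(\Omega,\mathbb P)$ satisfy the LDP with a convex rate function; $I_{\mathbb Q}:\mathbb R\to[0,\infty]$ denotes this rate function, which is infinite on $(-\infty,0)$. The limit $q_{\mathbb Q}(\alpha)=\lim_n\frac1n\ln\sum_{u\in\operatorname{supp}\mathbb P_n}\mathbb Q_n(u)^{-\alpha}\mathbb P_n(u)$ exists in $(-\infty,\infty]$ for every $\alpha\in\mathbb R$, and $q_{\mathbb Q}=I_{\mathbb Q}^*$, $I_{\mathbb Q}=q_{\mathbb Q}^*$. *)

(* Defs.v *)
From HB Require Import structures.
From mathcomp Require Import all_boot all_order all_algebra.
From mathcomp Require Import all_classical all_reals all_analysis.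
From mathcomp Require Import measurable_realfun.

Set Implicit Arguments.
Unset Strict Implicit.
Unset Printing Implicit Defensive.

Import Order.TTheory GRing.Theory Num.Theory.
Import numFieldNormedType.Exports.

Local Open Scope classical_set_scope.
Local Open Scope ring_scope.
Local Open Scope ereal_scope.

(* Measurable types are pointed in the library. The base point only says that
   the alphabet is nonempty, which the existence of a probability measure on
   the sequence space forces anyway. *)
#[short(type="alphabetType")]
HB.structure Definition Alphabet := {A of Finite A & Pointed A}.

Definition sequence_space (A : alphabetType) :=
  prod_topology (fun _ : nat => discrete_topology A).

(* Sequences are indexed from 0: the letter x_(i+1) of the 1-based convention
   is [x i]. The sigma-algebra is the Borel one of the product topology. *)
Definition Omega (A : alphabetType) :=
  g_sigma_algebraType (@open (sequence_space A)).

Section words.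
Context {R : realType} {A : alphabetType}.
Implicit Types (x y : Omega A) (P Q : probability (Omega A) R).

Definition shift x : Omega A := fun i => x i.+1.

Definition shift_invariant P :=
  forall B : set (Omega A), measurable B -> P (shift @^-1` B) = P B.

(* x_(k+1) ... x_(k+n) in the 1-based convention *)
Definition word x (k n : nat) : n.-tuple A := [tuple (x (k + i)%N : A) | i < n].

(* The law P_n of the first n letters; [set u] is sent to the measure of the
   cylinder of u. *)
Definition marginal P (n : nat) (B : set (n.-tuple A)) : \bar R :=
  P ((fun x => word x 0 n) @^-1` B).

(* +oo if the word x_1^n never occurs in y *)
Definition waiting_time (n : nat) x y : \bar R :=
  ereal_inf [set (k%:R : R)%:E | k in
    [set k : nat | (0 < k)%N /\ word y k.-1 n = word x 0 n]].

Definition log_waiting_time (n : nat) (xy : Omega A * Omega A) : \bar R :=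
  (n%:R^-1 : R)%:E * lne (waiting_time n xy.1 xy.2).

(* +oo if Q_n(x_1^n) = 0 *)
Definition neg_log_prob Q (n : nat) x : \bar R :=
  - ((n%:R^-1 : R)%:E * lne (marginal Q [set word x 0 n])).

Definition decoupling_sequences (tau : nat -> nat) (C : nat -> R) :=
  [/\ forall n, (0 < n)%N -> (1 <= C n)%R,
      ((fun n => (tau n)%:R / n%:R) @ \oo --> (0 : R))%R
    & ((fun n => ln (C n) / n%:R) @ \oo --> (0 : R))%R].

Definition UD (tau : nat -> nat) (C : nat -> R) P :=
  forall (n m : nat) (u : n.-tuple A) (v : m.-tuple A) (xi : (tau n).-tuple A),
    (0 < n)%N -> (0 < m)%N ->
    marginal P [set [tuple of u ++ xi ++ v]] <=
      (C n)%:E * marginal P [set u] * marginal P [set v].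

Definition JSLD (tau : nat -> nat) (C : nat -> R) P Q :=
  forall (n m : nat) (u : n.-tuple A) (v : m.-tuple A),
    (0 < n)%N -> (0 < m)%N ->
    exists l : nat, (l <= tau n)%N /\ exists xi : l.-tuple A,
      marginal P [set [tuple of u ++ xi ++ v]] >=
        ((C n)^-1)%:E * marginal P [set u] * marginal P [set v] /\
      marginal Q [set [tuple of u ++ xi ++ v]] >=
        ((C n)^-1)%:E * marginal Q [set u] * marginal Q [set v].

Definition admissible (tau : nat -> nat) (C : nat -> R) P Q :=
  [/\ forall n, (0 < n)%N -> forall B : set (n.-tuple A),
        marginal Q B = 0 -> marginal P B = 0,
      UD tau C P, UD tau C Q & JSLD tau C P Q].

Definition scaled_cgf_prob P Q (alpha : R) (n : nat) : \bar R :=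
  (n%:R^-1 : R)%:E *
  lne (\sum_(u : n.-tuple A | 0 < marginal P [set u])
         poweR (marginal Q [set u]) (- alpha)%R * marginal P [set u]).

Definition scaled_cgf_waiting P Q (alpha : R) (n : nat) : \bar R :=
  (n%:R^-1 : R)%:E *
  lne (\int[Q]_y \int[P]_x expeR (alpha%:E * lne (waiting_time n x y))).

End words.

Section large_deviations.
Context {R : realType}.
Implicit Types (I f : R -> \bar R).

Definition rate_function I := (forall s, 0 <= I s) /\ lower_semicontinuous I.

Definition good_rate_function I :=
  [/\ rate_function I,
      I s @[s --> +oo%R] --> +oo & I s @[s --> -oo%R] --> +oo].

Definition econvex f :=
  forall (s t lambda : R), (0 <= lambda <= 1)%R ->
    f (lambda * s + (1 - lambda) * t)%R <=
      lambda%:E * f s + (1 - lambda)%:E * f t.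

Definition legendre f (alpha : R) : \bar R :=
  ereal_sup [set (alpha * s)%:E - f s | s in [set: R]].

(* The random variables are real-valued outside a null set; events are read on
   the real line, through [EFin]. The index 0 is not part of the sequence. *)
Definition LDP d (T : measurableType d) (P : probability T R)
    (Z : nat -> T -> \bar R) I :=
  [/\ forall n, (0 < n)%N ->
        measurable_fun setT (Z n) /\ {ae P, forall w, Z n w \is a fin_num},
      rate_function I,
      forall O : set R, open O ->
        - ereal_inf (I @` O) <=
          limn_einf (fun n => (n%:R^-1 : R)%:E * lne (P (Z n @^-1` (EFin @` O))))
    & forall F : set R, closed F ->
        limn_esup (fun n => (n%:R^-1 : R)%:E * lne (P (Z n @^-1` (EFin @` F)))) <=
          - ereal_inf (I @` F)].

Definition exponentially_tight d (T : measurableType d) (P : probability T R)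
    (Z : nat -> T -> \bar R) :=
  forall beta : R, exists M : R, (0 < M)%R /\
    \forall n \near \oo,
      P (Z n @^-1` (~` (EFin @` `[(- M)%R, M]))) <= (expR (- (beta * n%:R)))%:E.

Definition waiting_rate (IQ : R -> \bar R) (s : R) : \bar R :=
  if (s < 0)%R then +oo
  else ereal_inf [set (r - s)%:E + IQ r | r in [set r : R | (s <= r)%R]].

End large_deviations.

(* Main.v *)
Require Import Defs.
From HB Require Import structures.
From mathcomp Require Import all_boot all_order all_algebra.
From mathcomp Require Import all_classical all_reals all_analysis.
From mathcomp Require Import measurable_realfun.
From mathcomp Require Import ring lra zify.

Set Implicit Arguments.
Unset Strict Implicit.
Unset Printing Implicit Defensive.

Import Order.TTheory GRing.Theory Num.Theory.
Import numFieldNormedType.Exports.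

Local Open Scope classical_set_scope.
Local Open Scope ring_scope.
Local Open Scope ereal_scope.

(** Write [q] for the [Q]-probability of a word [u] of length [n]. On the
    exponential scale the waiting time of [u] in a [Q]-random sequence is
    [1/q], with explicit control on both sides. A union bound over starting
    positions gives Q(W <= k) <= k q ([prob_missC_le]). Conversely, lower
    decoupling inserts [u] in front of any word at the cost of a factor
    [q / C n], so each stretch of [n + tau n] letters behaves like a fresh trial
    and Q(W > j (n + tau n)) <= (1 - q / C n) ^ j ([prob_miss_le]). The rest of
    the proof transfers what is known about Q_n(x_1^n) through these bounds.

    Upper bound on moments. For alpha >= 0 the geometric tail gives that
    E W^alpha is at most q^-alpha up to a sub-exponential factor
    ([moment_pos_le]). For -1 <= alpha < 0 the union bound gives the same
    estimate, with a remainder that decays at any prescribed rate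
    ([moment_neg_le]), and below -1 monotonicity in alpha takes over.
    Averaging over [u], the growth rate of E W^alpha is at most
    max(q_Q(alpha), q_Q(-1)) ([growth_mean_waiting_power]).

    Duality. Exchanging two suprema identifies this maximum with the Legendre
    transform of I_W ([waiting_cgf_duality]). In the other direction, I_Q is the
    supremum of its affine minorants; the definition of I_W is exactly what
    permits to replace a slope below -1 by -1 ([waiting_rate_duality]). That I_W
    is convex and lower semicontinuous is then automatic.

    Lower bounds. The cheapest way to get W close to e^(ns) is to have
    Q_n(x_1^n) close to e^(-nr) for some r >= s, which costs I_Q(r), and then an
    early occurrence of the word, which costs r - s ([word_hit_window],
    [growth_window]). This is the lower bound of the large deviation principle.
    Reading Chernoff's inequality backwards turns it into the missing lower bound
    on moments ([growth_mean_waiting_power_ge]).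

    Upper bounds. I_W is convex with infimum 0, so for a closed set F and a point
    t of rate smaller than the infimum over F, the points of F nearest to t on
    either side dominate, and they are handled by Chernoff's inequality
    ([waiting_tail], [growth_closed]).

    When P = Q, the sum of P_n(u) / Q_n(u) over the support counts words, so
    q_W(1) is finite; goodness and exponential tightness follow from that. *)

(** * Exponential growth rates *)

Section growth.
Context {R : realType}.
Implicit Types (a b : nat -> \bar R) (l : \bar R) (z : R).

Definition log_rate a (n : nat) : \bar R := (n%:R^-1 : R)%:E * lne (a n).

Lemma log_rate_le a n z : (0 < n)%N ->
  (log_rate a n <= z%:E) = (a n <= (expR (n%:R * z))%:E).
Proof.
move=> n0; rewrite /log_rate; case: (a n) => [r| |].
- have n0' : (0 < n%:R :> R)%R by rewrite ltr0n.
  have [r0|r0] := leP r 0%R.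
    rewrite le0_lneNy ?lee_fin// gt0_muleNy ?lte_fin ?invr_gt0// leNye.
    by rewrite (le_trans r0) ?expR_ge0.
  rewrite lne_EFin// -EFinM !lee_fin ler_pdivrMl//.
  by rewrite -{2}[r]lnK ?posrE// ler_expR.
- by rewrite /= gt0_muley// lte_fin invr_gt0 ltr0n.
- by rewrite /= gt0_muleNy ?leNye// lte_fin invr_gt0 ltr0n.
Qed.

Lemma log_rate_ge a n z : (0 < n)%N ->
  (z%:E <= log_rate a n) = ((expR (n%:R * z))%:E <= a n).
Proof.
move=> n0; rewrite /log_rate; case: (a n) => [r| |].
- have n0' : (0 < n%:R :> R)%R by rewrite ltr0n.
  have [r0|r0] := leP r 0%R.
    rewrite le0_lneNy ?lee_fin// gt0_muleNy ?lte_fin ?invr_gt0//.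
    by rewrite leeNy_eq/= leNgt (le_lt_trans r0)// expR_gt0.
  rewrite lne_EFin// -EFinM !lee_fin ler_pdivlMl//.
  by rewrite -{2}[r]lnK ?posrE// ler_expR.
- by rewrite /= gt0_muley ?leey// lte_fin invr_gt0 ltr0n.
- by rewrite /= gt0_muleNy// lte_fin invr_gt0 ltr0n.
Qed.

(** Comparison with exponentials on the original scale. Sums, products and
    inequalities between probabilities are easier to handle in this form than
    upper and lower limits of rescaled logarithms, which may be infinite. *)
Definition growth_le a l := forall z, l < z%:E ->
  \forall n \near \oo, a n <= (expR (n%:R * z))%:E.

Definition growth_ge a l := forall z, z%:E < l ->
  \forall n \near \oo, (expR (n%:R * z))%:E <= a n.

Lemma lte_real_between (x y : \bar R) : x < y -> exists z, x < z%:E < y.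
Proof.
case: x y => [x| |] [y| |] //=.
- rewrite lte_fin => xy; exists ((x + y) / 2)%R.
  by rewrite !lte_fin !midf_lt.
- by move=> _; exists (x + 1)%R; rewrite ltry lte_fin ltrDl ltr01.
- by move=> _; exists (y - 1)%R; rewrite ltNyr lte_fin gtrBl ltr01.
- by move=> _; exists 0%R; rewrite ltNyr ltry.
Qed.

Lemma le_of_real_upper (x y : \bar R) :
  (forall z, y < z%:E -> x <= z%:E) -> x <= y.
Proof.
move=> h; rewrite leNgt; apply/negP => /lte_real_between[z /andP[yz zx]].
by have := h _ yz; rewrite leNgt zx.
Qed.

Lemma ge_of_real_lower (x y : \bar R) :
  (forall z, z%:E < y -> z%:E <= x) -> y <= x.
Proof.
move=> h; rewrite leNgt; apply/negP => /lte_real_between[z /andP[yz zx]].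
by have := h _ zx; rewrite leNgt yz.
Qed.

Lemma limn_esup_le_near (u : nat -> \bar R) z :
  (\forall n \near \oo, u n <= z%:E) -> limn_esup u <= z%:E.
Proof.
move=> [N _ h]; rewrite /limn_esup limf_esupE.
apply: ereal_inf_le; exists (ereal_sup (u @` [set n | (N <= n)%N])).
  by exists [set n | (N <= n)%N] => //; exists N.
by apply: ge_ereal_sup => _ [n Nn <-]; exact: h.
Qed.

Lemma limn_einf_ge_near (u : nat -> \bar R) z :
  (\forall n \near \oo, z%:E <= u n) -> z%:E <= limn_einf u.
Proof.
move=> h; rewrite /limn_einf leeNr; apply: limn_esup_le_near.
by apply: filterS h => n; rewrite EFinN leeN2.
Qed.

Lemma limn_einf_gt_near (u : nat -> \bar R) z :
  z%:E < limn_einf u -> \forall n \near \oo, z%:E <= u n.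
Proof.
rewrite /limn_einf lteNr /limn_esup limf_esupE => /ereal_inf_lt[_ [V [N _ NV] <-]].
move=> h; exists N => // n Nn.
have : - u n <= ereal_sup ((\- u) @` V).
  by apply: ereal_sup_ubound; exists n => //; exact: NV.
by move=> /le_lt_trans/(_ h); rewrite lteN2 => /ltW.
Qed.

Lemma growth_le_limn_esup a l : growth_le a l -> limn_esup (log_rate a) <= l.
Proof.
move=> al; apply: le_of_real_upper => z lz; apply: limn_esup_le_near.
near=> n; rewrite log_rate_le; last by near: n; exists 1%N.
by near: n; exact: al.
Unshelve. all: by end_near. Qed.

Lemma growth_ge_limn_einf a l : growth_ge a l -> l <= limn_einf (log_rate a).
Proof.
move=> al; apply: ge_of_real_lower => z lz; apply: limn_einf_ge_near.
near=> n; rewrite log_rate_ge; last by near: n; exists 1%N.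
by near: n; exact: al.
Unshelve. all: by end_near. Qed.

Lemma limn_einf_growth_ge a l : l <= limn_einf (log_rate a) -> growth_ge a l.
Proof.
move=> al z zl; near=> n.
rewrite -log_rate_ge; last by near: n; exists 1%N.
near: n; apply: limn_einf_gt_near; exact: lt_le_trans al.
Unshelve. all: by end_near. Qed.

Lemma cvg_growth_le a l : log_rate a @ \oo --> l -> growth_le a l.
Proof.
move=> al z lz; near=> n.
rewrite -log_rate_le; last by near: n; exists 1%N.
near: n; have /cvg_limn_einf_sup[_ h] := al.
have : (- z)%:E < limn_einf (\- log_rate a).
  rewrite -[(\- _)]/(-%E \o log_rate a) limn_einfN h.
  by rewrite EFinN lteN2.
move=> /limn_einf_gt_near; apply: filterS => n.
by rewrite EFinN leeN2.
Unshelve. all: by end_near. Qed.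

Lemma growth_cvg a l : growth_le a l -> growth_ge a l -> log_rate a @ \oo --> l.
Proof.
move=> hle hge.
have le_near z : l < z%:E -> \forall n \near \oo, log_rate a n <= z%:E.
  move=> lz; near=> n; rewrite log_rate_le; last by near: n; exists 1%N.
  by near: n; exact: hle.
have ge_near z : z%:E < l -> \forall n \near \oo, z%:E <= log_rate a n.
  move=> lz; near=> n; rewrite log_rate_ge; last by near: n; exists 1%N.
  by near: n; exact: hge.
case: l le_near ge_near {hle hge} => [r| |] le_near ge_near.
- apply/fine_cvgP; split.
    near=> n; rewrite fin_numElt.
    apply/andP; split.
      apply: (@lt_le_trans _ _ (r - 1)%:E); rewrite ?ltNyr//.
      by near: n; apply: ge_near; rewrite lte_fin gtrBl ltr01.
    apply: (@le_lt_trans _ _ (r + 1)%:E); rewrite ?ltry//.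
    by near: n; apply: le_near; rewrite lte_fin ltrDl ltr01.
  apply/cvgrPdist_le => e e0; near=> n.
  have h1 : (r - e)%:E <= log_rate a n.
    by near: n; apply: ge_near; rewrite lte_fin gtrBl.
  have h2 : log_rate a n <= (r + e)%:E.
    by near: n; apply: le_near; rewrite lte_fin ltrDl.
  rewrite /comp; case: (log_rate a n) h1 h2 => [x| |]//=.
  by rewrite !lee_fin ler_norml; lra.
- by apply/cvgeyPge => A; apply: ge_near; rewrite ltry.
- by apply/cvgeNyPle => A; apply: le_near; rewrite ltNyr.
Unshelve. all: by end_near. Qed.

(** With the next lemma, absorbs sub-exponential factors into an arbitrarily
    small change of the rate. *)
Lemma near_le_expR (K z : R) : (0 < z)%R ->
  \forall n \near \oo, (K <= expR (n%:R * z))%R.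
Proof.
move=> z0; near=> n.
apply: le_trans (expR_ge1Dx _); apply: (@le_trans _ _ (n%:R * z)%R); last by rewrite lerDr.
rewrite -ler_pdivrMr//; near: n; exact: nbhs_infty_ger.
Unshelve. all: by end_near. Qed.

Lemma near_natr_le_expR (z : R) : (0 < z)%R ->
  \forall n \near \oo, (n%:R <= expR (n%:R * z))%R.
Proof.
move=> z0; near=> n.
have h : (z^-1 *+ 2 <= expR (n%:R * (z / 2)))%R by near: n; apply: near_le_expR; rewrite divr_gt0.
have -> : (n%:R * z = n%:R * (z / 2) + n%:R * (z/2))%R by lra.
rewrite expRD.
have h2 : (n%:R * (z / 2) <= expR (n%:R * (z / 2)))%R.
  by apply: le_trans (expR_ge1Dx _); rewrite lerDr.
apply: (@le_trans _ _ ((z^-1 *+ 2) * (n%:R * (z / 2)))%R).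
  by rewrite le_eqVlt; apply/orP; left; apply/eqP; field; rewrite gt_eqF.
by rewrite ler_pM// ?mulr_ge0 ?mulrn_wge0 ?invr_ge0// ltW// divr_gt0.
Unshelve. all: by end_near. Qed.

Lemma growth_leW a l l' :
  l <= l' -> growth_le a l -> growth_le a l'.
Proof. by move=> ll h z lz; apply: h; exact: le_lt_trans lz. Qed.

Lemma growth_le_near a b l :
  (\forall n \near \oo, a n <= b n) -> growth_le b l -> growth_le a l.
Proof.
move=> ab h z lz; have hz := h z lz; near=> n.
by apply: (@le_trans _ _ (b n)); near: n.
Unshelve. all: by end_near. Qed.

Lemma growth_ge_near a b l :
  (\forall n \near \oo, b n <= a n) -> growth_ge b l -> growth_ge a l.
Proof.
move=> ab h z lz; have hz := h z lz; near=> n.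
by apply: (@le_trans _ _ (b n)); near: n.
Unshelve. all: by end_near. Qed.

(** A sum grows like its largest term; used to glue the two tails of a closed
    set. *)
Lemma le_expR_twice z1 z2 z : (z1 < z)%R -> (z2 < z)%R ->
  \forall n \near \oo, (expR (n%:R * z1) + expR (n%:R * z2) <= expR (n%:R * z))%R.
Proof.
move=> h1 h2; pose m := Num.max z1 z2.
have hm : (0 < z - m)%R by rewrite subr_gt0 /m gt_max h1.
near=> n.
have h : (2 <= expR (n%:R * (z - m)))%R by near: n; exact: near_le_expR.
apply: (@le_trans _ _ (2 * expR (n%:R * m))%R).
  have -> : (2 * expR (n%:R * m) = expR (n%:R * m) + expR (n%:R * m))%R by ring.
  by apply: lerD; rewrite ler_expR ler_wpM2l// /m le_max lexx ?orbT//.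
have -> : (n%:R * z = n%:R * (z - m) + n%:R * m)%R by ring.
by rewrite expRD ler_pM2r ?expR_gt0.
Unshelve. all: by end_near. Qed.

End growth.

Section gaps.
Context {R : realType}.
Variables (tau : nat -> nat) (C : nat -> R).
Hypothesis tauC : decoupling_sequences tau C.

(** The only way in which the decoupling gaps and constants enter: [n + tau n]
    is the length of a trial and [C n] the loss in its success probability. *)
Lemma decoupling_constants_subexp (z : R) : (0 < z)%R ->
  \forall n \near \oo, ((n + tau n)%:R * C n <= expR (n%:R * z))%R.
Proof.
move=> z0; case: tauC => C1 htau hC.
have z20 : (0 < z / 4)%R by rewrite divr_gt0.
near=> n.
have n0 : (0 < n)%N by near: n; exists 1%N.
have n0' : (0 < n%:R :> R)%R by rewrite ltr0n.
have htn : ((tau n)%:R / n%:R <= 1 :> R)%R.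
  near: n; move/cvgrPdist_le: htau => /(_ 1%R ltr01).
  by apply: filterS => n; rewrite sub0r normrN => /(le_trans (ler_norm _)).
have hCn : (ln (C n) / n%:R <= z / 4)%R.
  near: n; move/cvgrPdist_le: hC => /(_ _ z20).
  by apply: filterS => n; rewrite sub0r normrN => /(le_trans (ler_norm _)).
have hn : (n%:R <= expR (n%:R * (z / 4)))%R by near: n; exact: near_natr_le_expR.
have h2 : (2 <= expR (n%:R * (z / 4)))%R by near: n; exact: near_le_expR.
have hC0 : (C n <= expR (n%:R * (z / 4)))%R.
  have C0 : (0 < C n)%R by rewrite (lt_le_trans ltr01)// C1.
  by rewrite -[X in (X <= _)%R]lnK ?posrE// ler_expR mulrC -ler_pdivrMr.
have ht : ((n + tau n)%:R <= 2 * n%:R :> R)%R.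
  by rewrite natrD mulr_natl mulr2n lerD2l; move: htn; rewrite ler_pdivrMr// mul1r.
have -> : (n%:R * z = n%:R * (z / 4) + n%:R * (z/4) + n%:R * (z/4) + n%:R * (z/4))%R by lra.
rewrite !expRD.
have E0 := expR_gt0 (n%:R * (z / 4))%R.
have E1 : (1 <= expR (n%:R * (z / 4)))%R by lra.
have C1n := C1 n n0.
set E := expR _ in E0 E1 hn h2 hC0 *.
apply: (@le_trans _ _ ((E * E) * E)%R).
  apply: ler_pM => //; first lra.
  by apply: (le_trans ht); apply: ler_pM => //; lra.
by rewrite ler_peMr// !mulr_ge0// ltW.
Unshelve. all: by end_near. Qed.
End gaps.

(** * Words, cylinders and first occurrences *)

Section words.
Context {R : realType} {A : alphabetType}.
Implicit Types (x y : Omega A) (P Q : probability (Omega A) R).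

Lemma word_cat_inv y k n m (u : n.-tuple A) (v : m.-tuple A) :
  word y k (n + m) = [tuple of u ++ v] ->
  word y k n = u /\ word y (k + n)%N m = v.
Proof.
move=> h; split; apply: eq_from_tnth => i; rewrite tnth_mktuple.
  have := congr1 (fun t => tnth t (lshift m i)) h.
  by rewrite tnth_mktuple tnth_lshift.
have := congr1 (fun t => tnth t (rshift n i)) h.
by rewrite tnth_mktuple tnth_rshift /= addnA.
Qed.

(** Whether a word occurs at a given place is decided by any window containing
    it, wherever this window is read. *)
Lemma word_subword x x' a b m j n : (j + n <= m)%N ->
  word x a m = word x' b m -> word x (a + j) n = word x' (b + j) n.
Proof.
move=> jnm h; apply: eq_from_tnth => i; rewrite !tnth_mktuple.
have jim : (j + i < m)%N by rewrite (leq_trans _ jnm)// ltn_add2l.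
have := congr1 (fun t => tnth t (Ordinal jim)) h.
by rewrite !tnth_mktuple /= !addnA.
Qed.

Lemma measurable_letter i (a : A) : measurable [set x : Omega A | x i = a].
Proof.
apply: sub_sigma_algebra.
rewrite [X in open X](_ : _ = (fun x : sequence_space A => proj i x) @^-1` [set a])//.
apply: open_comp; last exact: discrete_open.
by move=> x _; exact: proj_continuous.
Qed.

Lemma measurable_word k n (u : n.-tuple A) :
  measurable [set x : Omega A | word x k n = u].
Proof.
rewrite [X in measurable X](_ : _ =
    \bigcap_(i in [set: 'I_n]) [set x : Omega A | x (k + i)%N = tnth u i]).
  by apply: fin_bigcap_measurable => // i _; exact: measurable_letter.
apply/seteqP; split => x /=.
  by move=> <- i _; rewrite /= tnth_mktuple.
by move=> h; apply: eq_from_tnth => i; rewrite tnth_mktuple; exact: h.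
Qed.

Lemma measurable_word_pred k n (B : set (n.-tuple A)) :
  measurable [set x : Omega A | B (word x k n)].
Proof.
rewrite [X in measurable X](_ : _ =
    \bigcup_(u in B) [set x : Omega A | word x k n = u]).
  apply: fin_bigcup_measurable; first exact: finite_finset.
  by move=> u _; exact: measurable_word.
by apply/seteqP; split => x /= => [h|[u Bu ->]//]; exists (word x k n).
Qed.

Definition cyl_prob P n (u : n.-tuple A) : R := fine (marginal P [set u]).

Lemma marginalE P n (u : n.-tuple A) : marginal P [set u] = (cyl_prob P u)%:E.
Proof.
rewrite /cyl_prob fineK// /marginal fin_num_measure//.
exact: (measurable_word 0 u).
Qed.

Lemma cyl_prob_ge0 P n (u : n.-tuple A) : (0 <= cyl_prob P u)%R.
Proof. by rewrite -lee_fin -marginalE /marginal. Qed.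

Lemma cyl_prob_le1 P n (u : n.-tuple A) : (cyl_prob P u <= 1)%R.
Proof.
rewrite -lee_fin -marginalE; apply: probability_le1; exact: (measurable_word 0 u).
Qed.

Lemma prob_word P (Pinv : shift_invariant P) k n (u : n.-tuple A) :
  P [set x | word x k n = u] = (cyl_prob P u)%:E.
Proof.
elim: k => [|k <-]; first by rewrite -marginalE.
rewrite -(Pinv _ (measurable_word k u)); congr (P _).
Qed.

Lemma sum_word_indic k n (f : n.-tuple A -> \bar R) x :
  f (word x k n) = \sum_(u : n.-tuple A) f u * (\1_[set x | word x k n = u] x)%:E.
Proof.
rewrite (bigD1 (word x k n))//= indicE mem_set// mule1 big1 ?adde0// => u hu.
by rewrite indicE memNset ?mule0// => /= h; rewrite h eqxx in hu.
Qed.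

Lemma integral_word P k n (f : n.-tuple A -> \bar R) : (forall u, 0 <= f u) ->
  \int[P]_x f (word x k n) = \sum_(u : n.-tuple A) f u * P [set x | word x k n = u].
Proof.
move=> f0; under eq_integral do rewrite sum_word_indic.
rewrite ge0_integral_sum//; first last.
- by move=> u x _; rewrite mule_ge0// lee_fin.
- move=> u; apply: emeasurable_funM => //; apply/measurable_EFinP.
  by apply: measurable_indic; exact: measurable_word.
apply: eq_bigr => u _; rewrite ge0_integralZl//.
- by rewrite integral_indic ?setIT//; exact: measurable_word.
- by apply/measurable_EFinP; apply: measurable_indic; exact: measurable_word.
Qed.

(** The waiting time with the first sequence reduced to the word [u]. Separating
    [u] from [y] makes integration over the first sequence a finite sum. *)
Definition hit n (u : n.-tuple A) y : \bar R :=
  ereal_inf [set (k%:R : R)%:E | k in [set k : nat | (0 < k)%N /\ word y k.-1 n = u]].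

Lemma waiting_timeE n x y : waiting_time n x y = hit (word x 0 n) y.
Proof. by []. Qed.

(** The event that the waiting time exceeds [r]. *)
Definition miss n (u : n.-tuple A) (r : nat) : set (Omega A) :=
  [set y | forall j, (j < r)%N -> word y j n <> u].

Lemma missW n (u : n.-tuple A) r s : (r <= s)%N -> miss u s `<=` miss u r.
Proof. by move=> rs y h j jr; apply: h; exact: leq_trans rs. Qed.

Lemma hit_le n (u : n.-tuple A) y j : word y j n = u -> hit u y <= (j.+1%:R)%:E.
Proof. by move=> h; apply: ereal_inf_lbound; exists j.+1. Qed.

Lemma miss_hit n (u : n.-tuple A) y r : miss u r y -> (r.+1%:R)%:E <= hit u y.
Proof.
move=> h; apply: le_ereal_inf_tmp => _ [[|k] [// _ hk] <-].
rewrite lee_fin ler_nat ltnS leqNgt; apply/negP => kr; exact: h hk.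
Qed.

Lemma hit_ge1 n (u : n.-tuple A) y : 1 <= hit u y.
Proof. by apply: (@miss_hit _ _ _ 0). Qed.

Lemma hit_leP n (u : n.-tuple A) y (t : R) :
  hit u y <= t%:E <-> ~ miss u (Num.truncn t) y.
Proof.
split=> [ht /miss_hit h|].
  have := le_trans h ht; rewrite lee_fin leNgt => /negP; apply.
  exact: truncnS_gt.
move=> h; have [j jt hj] : exists2 j, (j < Num.truncn t)%N & word y j n = u.
  apply: contrapT => h'; apply: h => j jt hj; apply: h'; by exists j.
apply: (le_trans (hit_le hj)); rewrite lee_fin -truncn_ge_nat//.
by rewrite leNgt; apply/negP => t0; rewrite truncn_floor leNgt t0 in jt.
Qed.

Lemma measurable_miss n (u : n.-tuple A) r : measurable (miss u r).
Proof.
elim: r => [|r ih].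
  by rewrite [miss u 0](_ : _ = setT)//; apply/seteqP; split.
rewrite (_ : miss u r.+1 = miss u r `&` ~` [set y | word y r n = u]).
  by apply: measurableI => //; apply: measurableC; exact: measurable_word.
apply/seteqP; split => y.
  by move=> h; split; [exact: missW h | exact: h].
by move=> [h1 h2] j; rewrite ltnS leq_eqVlt => /predU1P[->//|]; exact: h1.
Qed.

Lemma measurable_hit n (u : n.-tuple A) : measurable_fun setT (hit u).
Proof.
pose f k y : \bar R := if word y k n == u then (k.+1%:R)%:E else +oo.
rewrite (_ : hit u = fun y => einfs (f^~ y) 0%N).
  apply: measurable_fun_einfs => k; apply: measurable_fun_ifT => //.
  apply: (measurable_fun_bool true); rewrite setTI.
  rewrite [X in measurable X](_ : _ = [set y | word y k n = u]).
    exact: measurable_word.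
  by apply/seteqP; split => y /= /eqP.
apply/funext => y; apply/eqP; rewrite eq_le; apply/andP; split.
  apply: le_ereal_inf_tmp => _ [k _ <-]; rewrite /f.
  by case: eqP => [/hit_le//|_]; rewrite leey.
apply: le_ereal_inf_tmp => _ [[|k] [// _ hk] <-].
by apply: ereal_inf_lbound; exists k => //; rewrite /f -hk eqxx.
Qed.

Lemma prob_split_word P k m (E : set (Omega A)) : measurable E ->
  P E = \sum_(v : m.-tuple A) P (E `&` [set y | word y k m = v]).
Proof.
move=> mE; have mEv v : measurable (E `&` [set y : Omega A | word y k m = v]).
  by apply: measurableI => //; exact: measurable_word.
transitivity (\int[P]_y (\1_E y)%:E); first by rewrite integral_indic// setIT.
under eq_integral => y _.
  rewrite (sum_word_indic k (fun _ : m.-tuple A => (\1_E y)%:E) y).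
  under eq_bigr do rewrite -EFinM -[(_ * _)%R]/((\1_E \* \1_ _) y)%R -indicI.
  over.
rewrite ge0_integral_sum//; last by move=> v; exact/measurable_EFinP/measurable_indic.
by apply: eq_bigr => v _; rewrite integral_indic// setIT.
Qed.

(** Union bound over the [r] possible starting positions, all of the same
    probability by shift invariance. *)
Lemma prob_missC_le P (Pinv : shift_invariant P) n (u : n.-tuple A) r :
  P (~` miss u r) <= (r%:R * cyl_prob P u)%:E.
Proof.
elim: r => [|r ih].
  rewrite mul0r [X in P X](_ : _ = set0) ?measure0//.
  by apply/seteqP; split => // y; apply.
apply: (@le_trans _ _ (P (~` miss u r `|` [set y | word y r n = u]))).
  apply: le_measure; rewrite ?inE.
  - by apply: measurableC; exact: measurable_miss.
  - by apply: measurableU; [apply: measurableC; exact: measurable_miss | exact: measurable_word].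
  move=> y /= h; have [hr|hr] := pselect (word y r n = u); first by right.
  left=> h'; apply: h => j; rewrite ltnS leq_eqVlt => /predU1P[->//|]; exact: h'.
apply: (le_trans (measureU2 _ _ _)).
- by apply: measurableC; exact: measurable_miss.
- exact: measurable_word.
by rewrite -natr1 mulrDl mul1r EFinD; apply: leeD; last rewrite -(prob_word Pinv r u).
Qed.

(** One more trial. Condition on the word [v] read after the first [n + t]
    letters, where [v] is long enough to decide whether [u] is missed at the last
    [r] starting positions. By the hypothesis on [c], a proportion at least [c] of
    the sequences carrying [v] there also carry [u xi] just before it, for some
    [xi] of length at most [t], and such sequences do not miss [u]. *)
Lemma prob_miss_step P (Pinv : shift_invariant P) n (u : n.-tuple A) t (c : R) r :
  (0 < n)%N -> (c <= 1)%R ->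
  (forall m (v : m.-tuple A), (0 < m)%N -> exists l, (l <= t)%N /\
    exists xi : l.-tuple A,
      (c * cyl_prob P v <= cyl_prob P [tuple of u ++ xi ++ v])%R) ->
  P (miss u (r + (n + t))) <= (1 - c)%:E * P (miss u r).
Proof.
move=> n0 c1 hc; pose m := (r + n)%N.
have m0 : (0 < m)%N by rewrite addn_gt0 n0 orbT.
rewrite (prob_split_word _ (n + t) m (measurable_miss u _)).
rewrite (prob_split_word _ 0 m (measurable_miss u r)).
rewrite ge0_sume_distrr//; apply: lee_sum => v _.
have mW k j (w : j.-tuple A) : measurable [set y : Omega A | word y k j = w].
  exact: measurable_word.
have mM k : measurable (miss u k) by exact: measurable_miss.
have [Bv|Bv] := pselect (forall y : Omega A, word y 0 m = v -> miss u r y); last first.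
  rewrite [X in P X](_ : _ = set0) ?measure0.
    by rewrite mule_ge0// lee_fin subr_ge0.
  apply/seteqP; split => // y [hy hv]; apply: Bv => y' hv' j jr hj.
  apply: (hy (n + t + j)%N); first by rewrite addnC ltn_add2r.
  rewrite -hj -[in RHS](add0n j); apply: (@word_subword _ _ _ _ m).
    by rewrite /m leq_add2r ltnW.
  by rewrite hv hv'.
rewrite (_ : miss u r `&` _ = [set y | word y 0 m = v]); last first.
  by apply/seteqP; split => [y []//|y hy]; split => //; exact: Bv.
have [l [lt [xi hxi]]] := hc m v m0.
rewrite (prob_word Pinv).
have -> : ((1 - c)%:E * (cyl_prob P v)%:E = (cyl_prob P v)%:E - (c * cyl_prob P v)%:E)%E.
  by rewrite -EFinM -EFinB mulrBl mul1r.
rewrite leeBrDr//.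
pose Y := [set y : Omega A | word y (t - l) (n + (l + m)) = [tuple of u ++ xi ++ v]].
apply: (@le_trans _ _ (P (miss u (r + (n + t)) `&` [set y | word y (n + t) m = v]) + P Y)).
  by rewrite leeD2l// prob_word// lee_fin.
rewrite -measureU//; last 3 first.
- exact: measurableI.
- exact: mW.
- apply/seteqP; split => // y [[hy _] /word_cat_inv[hu _]].
  apply: (hy _ _ hu); lia.
rewrite -(prob_word Pinv (n + t) v); apply: le_measure; rewrite ?inE//.
  by apply: measurableU; [exact: measurableI|exact: mW].
move=> y [[]//|/word_cat_inv[_ /word_cat_inv[_ /= hv]]].
by rewrite (_ : n + t = t - l + n + l)%N//; lia.
Qed.

Lemma prob_miss_le P (Pinv : shift_invariant P) n (u : n.-tuple A) t (c : R) j :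
  (0 < n)%N -> (c <= 1)%R ->
  (forall m (v : m.-tuple A), (0 < m)%N -> exists l, (l <= t)%N /\
    exists xi : l.-tuple A,
      (c * cyl_prob P v <= cyl_prob P [tuple of u ++ xi ++ v])%R) ->
  P (miss u (j * (n + t))) <= ((1 - c) ^+ j)%:E.
Proof.
move=> n0 c1 hc; elim: j => [|j ih].
  by rewrite expr0; apply: probability_le1; exact: measurable_miss.
rewrite mulSn addnC exprS EFinM.
apply: le_trans (prob_miss_step _ _ n0 c1 hc) _ => //.
by rewrite lee_wpmul2l// lee_fin subr_ge0.
Qed.

(** Sections along the first coordinate depend only on its first [n] letters. *)
Lemma prod_word_event P Q n (G : n.-tuple A -> set (Omega A)) :
  (P \x Q) [set xy | G (word xy.1 0 n) xy.2] =
  \sum_(u : n.-tuple A) (cyl_prob P u)%:E * Q (G u).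
Proof.
rewrite /= /product_measure1 /=.
under eq_integral => x _.
  rewrite (_ : xsection _ x = G (word x 0 n)); last first.
    by apply/seteqP; split => y; rewrite /xsection/= inE.
  over.
rewrite (@integral_word P 0 n (fun u => Q (G u)))//.
by apply: eq_bigr => u _; rewrite -marginalE muleC.
Qed.

Lemma measurable_word_pair n (E : n.-tuple A -> set (Omega A)) :
  (forall u, measurable (E u)) ->
  measurable [set xy : Omega A * Omega A | E (word xy.1 0 n) xy.2].
Proof.
move=> mE; rewrite [X in measurable X](_ : _ =
   \bigcup_(u in [set: n.-tuple A]) ([set x | word x 0 n = u] `*` E u)).
  apply: fin_bigcup_measurable; first exact: finite_finset.
  by move=> u _; apply: measurableX => //; exact: measurable_word.
apply/seteqP; split => [[x y] /= h|[x y] [u _ [/= -> //]]].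
by exists (word x 0 n).
Qed.

Definition moment Q (alpha : R) n (u : n.-tuple A) : \bar R :=
  \int[Q]_y expeR (alpha%:E * lne (hit u y)).

Lemma hit_cases n (u : n.-tuple A) y :
  hit u y = +oo \/ exists k : nat, hit u y = (k.+1%:R)%:E.
Proof.
have [[k0 hk0]|h] := pselect (exists k, word y k n = u); last first.
  left; apply/ereal_inf_pinfty => v [k [_ hk] _]; case: h; by exists k.-1.
right; have ex : exists k, word y k n == u by exists k0; apply/eqP.
case: (ex_minnP ex) => k /eqP hk kmin; exists k; apply/eqP; rewrite eq_le hit_le//=.
by apply: miss_hit => j jk hj; have := kmin j; rewrite hj eqxx leqNgt jk => /(_ isT).
Qed.

(** [hit] takes countably many values, so this covers [lne] and [expeR] without
    a separate study of these functions. *)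
Lemma measurable_comp_hit (f : \bar R -> \bar R) n (u : n.-tuple A) :
  measurable_fun setT (fun y => f (hit u y)).
Proof.
move=> _ B mB; rewrite setTI.
have mv v : measurable [set y | hit u y = v].
  have := measurable_hit u measurableT (emeasurable_set1 v).
  by rewrite setTI.
rewrite [X in measurable X](_ : _ =
  (\bigcup_(k in [set k : nat | B (f (k.+1%:R)%:E)]) [set y | hit u y = (k.+1%:R)%:E])
   `|` (if `[<B (f +oo)>] then [set y | hit u y = +oo] else set0)).
  apply: measurableU; last by case: ifP.
  by apply: bigcup_measurable => k _; exact: mv.
apply/seteqP; split => y /=.
  case: (hit_cases u y) => [hy|[k hy]]; rewrite hy => h.
    by right; rewrite asboolT.
  by left; exists k.
by case=> [[k Bk /= ->//]|]; case: asboolP => // ? /= ->.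
Qed.

Lemma scaled_cgf_waitingE P Q (alpha : R) :
  scaled_cgf_waiting P Q alpha =
  log_rate (fun n => \sum_(u : n.-tuple A) (cyl_prob P u)%:E * moment Q alpha u).
Proof.
apply/funext => n; rewrite /scaled_cgf_waiting /log_rate; congr (_ * lne _).
under eq_integral => y _.
  rewrite (@integral_word P 0 n (fun u => expeR (alpha%:E * lne (hit u y)))); last first.
    by move=> u; exact: expeR_ge0.
  over.
rewrite /= ge0_integral_sum//; first last.
- by move=> u y _; rewrite mule_ge0// expeR_ge0.
- move=> u; apply: emeasurable_funM => //.
  exact: (measurable_comp_hit (fun h => expeR (alpha%:E * lne h))).
apply: eq_bigr => u _; rewrite muleC -ge0_integralZr//.
- by rewrite -marginalE.
- exact: (measurable_comp_hit (fun h => expeR (alpha%:E * lne h))).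
- by move=> y _; exact: expeR_ge0.
- by rewrite lee_fin cyl_prob_ge0.
Qed.

Lemma moment_ge0 Q (alpha : R) n (u : n.-tuple A) : 0 <= moment Q alpha u.
Proof. by apply: integral_ge0 => y _; exact: expeR_ge0. Qed.

(** Chernoff's inequality for an arbitrary set of values [B] on which
    [alpha * e] is bounded below; the sign of [alpha] decides which tail this
    controls. *)
Lemma prob_hit_le_moment Q (alpha kappa : R) n (u : n.-tuple A) (B : set (\bar R)) :
  (0 < n)%N -> measurable B ->
  (forall e, B e -> kappa%:E <= alpha%:E * e) ->
  Q [set y | B ((n%:R^-1 : R)%:E * lne (hit u y))] <=
    (expR (- (n%:R * kappa)))%:E * moment Q alpha u.
Proof.
move=> n0 mB hB; have n0' : (0 < n%:R :> R)%R by rewrite ltr0n.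
set E := [set y | _]; have mE : measurable E.
  have := measurable_comp_hit (fun h => (n%:R^-1)%:E * lne h) u measurableT mB.
  by rewrite setTI.
have -> : Q E = \int[Q]_y (\1_E y)%:E by rewrite integral_indic ?setIT.
rewrite -ge0_integralZl//; last 2 first.
- exact: (measurable_comp_hit (fun h => expeR (alpha%:E * lne h))).
- by move=> y _; exact: expeR_ge0.
apply: ge0_le_integral => //.
- by apply/measurable_EFinP; exact: measurable_indic.
- apply: emeasurable_funM => //.
  exact: (measurable_comp_hit (fun h => expeR (alpha%:E * lne h))).
move=> y _; rewrite indicE; have [/set_mem yE|_] := boolP (y \in E); last first.
  by rewrite mule_ge0 ?expeR_ge0// lee_fin expR_ge0.
rewrite -[(expR _)%:E]/(expeR (- (n%:R * kappa))%:E) -expeRD -[X in X%:E]expR0.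
rewrite -[(expR 0)%:E]/(expeR 0%:E) lee_expeR.
have -> : alpha%:E * lne (hit u y) = n%:R%:E * (alpha%:E * (n%:R^-1%:E * lne (hit u y))).
  rewrite [in RHS]muleCA [in RHS](muleA n%:R%:E) -EFinM divff ?mul1e//.
  by rewrite gt_eqF.
rewrite EFinN addeC sube_ge0 ?fin_numE// EFinM lee_pmul2l ?lte_fin//.
exact: hB.
Qed.


Lemma log_waiting_time_measurable n :
  measurable_fun setT (@log_waiting_time R A n).
Proof.
move=> _ B mB; rewrite setTI.
have := @measurable_word_pair n (fun u => [set y | B ((n%:R^-1 : R)%:E * lne (hit u y))]).
apply=> u; rewrite -[X in measurable X]setTI.
exact: (measurable_comp_hit (fun h => (n%:R^-1)%:E * lne h)).
Qed.

(** * Moments of the first occurrence *)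

Lemma not_miss_hit n (u : n.-tuple A) r y : ~ miss u r y -> hit u y <= (r%:R)%:E.
Proof. by move=> h; apply/hit_leP; rewrite natrK. Qed.

Lemma lne_ge0_hit n (u : n.-tuple A) y : 0 <= lne (hit u y).
Proof. by rewrite lne_ge0 hit_ge1. Qed.

Lemma measurable_hit_expeR (alpha : R) n (u : n.-tuple A) :
  measurable_fun setT (fun y => expeR (alpha%:E * lne (hit u y))).
Proof. exact: (measurable_comp_hit (fun h => expeR (alpha%:E * lne h))). Qed.

Lemma expeR_lne_gt n (u : n.-tuple A) y (b theta : R) : (0 <= theta)%R -> (0 <= b)%R ->
  (expR b)%:E < hit u y ->
  expeR ((- theta)%:E * lne (hit u y)) <= (expR (- (theta * b)))%:E.
Proof.
move=> th0 b0 h; rewrite -[(expR (- _))%:E]/(expeR (- (theta * b))%:E) lee_expeR.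
rewrite !EFinN mulNe leeN2 EFinM; apply: lee_wpmul2l; first by rewrite lee_fin.
rewrite -[b%:E]expeRK lee_lne ?ltW//.
  by rewrite in_itv/= leey lee_fin expR_ge0.
by rewrite in_itv/= leey (le_trans _ (hit_ge1 u y))// lee_fin.
Qed.

(** Cuts the range of the waiting time at the levels [exp (g i)]. With [m] fixed
    and [g] proportional to [n], the number of levels does not depend on [n]. *)
Lemma hit_negative_power_le n (u : n.-tuple A) y (g theta : R) m :
  (0 <= theta)%R -> (0 <= g)%R ->
  expeR ((- theta)%:E * lne (hit u y)) <=
   \sum_(i < m) (expR (- (i%:R * g * theta)))%:E *
     (\1_(~` miss u (Num.truncn (expR (g * i.+1%:R)))) y)%:E
   + (expR (- (m%:R * g * theta)))%:E.
Proof.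
move=> th0 g0; elim: m => [|m ih].
  rewrite big_ord0 add0e !mul0r oppr0.
  rewrite -[(expR 0)%:E]/(expeR 0%:E) lee_expeR EFinN mulNe.
  by rewrite -[0%:E]oppe0 leeN2 mule_ge0// lne_ge0_hit.
rewrite big_ord_recr/=.
have S0 : 0 <= \sum_(i < m) (expR (- (i%:R * g * theta)))%:E *
     (\1_(~` miss u (Num.truncn (expR (g * i.+1%:R)))) y)%:E.
  by apply: sume_ge0 => i _; rewrite mule_ge0// lee_fin ?expR_ge0// indicE.
have [h|h] := leP (hit u y) (expR (g * m.+1%:R))%:E.
  have -> : (\1_(~` miss u (Num.truncn (expR (g * m.+1%:R)))) y = 1 :> R)%R.
    by rewrite indicE mem_set//; exact/hit_leP.
  rewrite mule1.
  by apply: (le_trans ih); rewrite leeDl// lee_fin expR_ge0.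
have -> : (m.+1%:R * g * theta = theta * (g * m.+1%:R))%R by ring.
apply: (le_trans (expeR_lne_gt th0 _ h)); first by rewrite mulr_ge0.
rewrite leeDr// adde_ge0// mule_ge0 ?lee_fin ?expR_ge0// indicE.
Qed.

(** At each level, Q(W <= exp (g (i + 1))) is at most both 1 and
    [exp (g (i + 1)) * q], hence at most the [theta]-th power of the latter. This
    makes all [m] levels contribute equally, up to and including [theta = 1],
    where a direct summation would lose a logarithm of [q]. *)
Lemma moment_neg_le Q (Qinv : shift_invariant Q) n (u : n.-tuple A) (g theta : R) m :
  (0 <= theta <= 1)%R -> (0 <= g)%R -> (0 < cyl_prob Q u)%R ->
  moment Q (- theta) u <=
    (m%:R * expR (theta * (g + ln (cyl_prob Q u))) + expR (- (m%:R * g * theta)))%:E.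
Proof.
move=> /andP[th0 th1] g0 q0; set q := cyl_prob Q u in q0 *.
pose r i := Num.truncn (expR (g * i.+1%:R)).
have mE i : measurable (~` miss u (r i)).
  by apply: measurableC; exact: measurable_miss.
have mf i : measurable_fun setT (fun y : Omega A =>
    (expR (- (i%:R * g * theta)))%:E * (\1_(~` miss u (r i)) y)%:E).
  by apply: emeasurable_funM => //; apply/measurable_EFinP; exact: measurable_indic.
have f0 i (y : Omega A) : 0 <= (expR (- (i%:R * g * theta)))%:E * (\1_(~` miss u (r i)) y)%:E.
  by rewrite mule_ge0// lee_fin ?expR_ge0// indicE.
apply: (@le_trans _ _ (\int[Q]_y (\sum_(i < m) (expR (- (i%:R * g * theta)))%:E *
     (\1_(~` miss u (r i)) y)%:E + (expR (- (m%:R * g * theta)))%:E))).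
  apply: ge0_le_integral => //.
  - by move=> y _; exact: expeR_ge0.
  - exact: measurable_hit_expeR.
  - by apply: emeasurable_funD => //; apply: emeasurable_sum => i _; exact: mf.
  - by move=> y _; exact: hit_negative_power_le.
rewrite ge0_integralD//; last 2 first.
- by move=> y _; apply: sume_ge0.
- by apply: emeasurable_sum => i _; exact: mf.
rewrite integral_cst// [X in _ * X](@probability_setT _ _ _ Q) mule1 EFinD leeD2r//.
rewrite ge0_integral_sum//.
apply: (@le_trans _ _ (\sum_(i < m) (expR (theta * (g + ln q)))%:E)); last first.
  by rewrite sumEFin sumr_const card_ord mulr_natl.
apply: lee_sum => i _.
rewrite ge0_integralZl//; last first.
  by apply/measurable_EFinP; exact: measurable_indic.
rewrite integral_indic// setIT.
apply: (@le_trans _ _ ((expR (- (i%:R * g * theta)))%:E *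
   (expR (theta * (g * i.+1%:R + ln q)))%:E)); last first.
  by rewrite -EFinM -expRD lee_fin ler_expR -natr1; rewrite le_eqVlt; apply/orP; left; apply/eqP; ring.
apply: lee_wpmul2l; first by rewrite lee_fin expR_ge0.
have [h|h] := leP 0%R (g * i.+1%:R + ln q)%R.
  apply: (le_trans (probability_le1 _ (mE i))).
  by rewrite -[leLHS]/(1%R%:E) lee_fin -[leLHS]expR0 ler_expR mulr_ge0.
apply: (le_trans (prob_missC_le Qinv u (r i))).
rewrite lee_fin; apply: (@le_trans _ _ (expR (g * i.+1%:R + ln q))%R).
  rewrite expRD lnK ?posrE// ler_pM2r// -truncn_ge_nat ?expR_ge0//.
by rewrite ler_expR ler_nMl.
Qed.

(** The hypothesis, shared with the bound on positive moments below, says that the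
    waiting time has an exponential tail on the scale [S]. *)
Lemma prob_never_hit Q n (u : n.-tuple A) S :
  (forall i : nat, Q (miss u (i * S)) <= (expR (- i%:R))%:E) ->
  Q [set y | hit u y = +oo] = 0.
Proof.
move=> hS; apply/eqP; rewrite eq_le measure_ge0 andbT.
apply/lee_addgt0Pr => e e0; rewrite add0e.
pose i := (Num.truncn e^-1).+1.
have mo : measurable [set y | hit u y = +oo].
  have := measurable_hit u measurableT (emeasurable_set1 +oo).
  by rewrite setTI.
apply: (@le_trans _ _ (Q (miss u (i * S)))).
  apply: le_measure; rewrite ?inE//; first exact: measurable_miss.
  by move=> y /= hy j _ hj; have := hit_le hj; rewrite hy leye_eq.
apply: (le_trans (hS i)); rewrite lee_fin expRN.
rewrite invf_ple ?posrE ?expR_gt0//.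
apply: le_trans (expR_ge1Dx _); rewrite (le_trans (ltW (truncnS_gt _)))//.
by rewrite lerDr.
Qed.

Lemma power_le_expR (alpha : R) : (0 <= alpha)%R -> exists2 k : R, (0 < k)%R &
  forall i : nat, (expR (alpha * ln i.+1%:R) <= k * expR (i%:R / 2))%R.
Proof.
(* The bound is [ln (x / a) <= x / a]; any positive [a >= 2 * alpha] would do. *)
move=> a0; pose a := (2 * alpha + 1)%R.
have ap : (0 < a)%R by rewrite /a; lra.
exists (expR (alpha * ln a + 2^-1)); first exact: expR_gt0.
move=> i; rewrite -expRD ler_expR.
have i0 : (0 < i.+1%:R :> R)%R by [].
have h : (ln (i.+1%:R / a) <= i.+1%:R / a)%R by rewrite ltW// ln_sublinear// divr_gt0.
rewrite ln_div ?posrE// in h.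
have h2 : (alpha * (i.+1%:R / a) <= i.+1%:R / 2)%R.
  rewrite mulrA ler_pdivrMr// mulrAC ler_pdivlMr//.
  rewrite mulrAC [X in (_ <= X)%R]mulrC ler_pM2r// /a; lra.
have h3 : (alpha * (ln i.+1%:R - ln a) <= alpha * (i.+1%:R / a))%R by rewrite ler_wpM2l.
move: h2 h3; rewrite -natr1; lra.
Qed.

(** The exponential tail on scale [S] bounds the moment of order [alpha] by a
    constant times [S ^ alpha]. The constant depends on nothing but [alpha], hence
    is negligible on the exponential scale. *)
Lemma moment_pos_le (alpha : R) : (0 <= alpha)%R -> exists2 K : R, (0 < K)%R &
  forall Q n (u : n.-tuple A) S, (0 < S)%N ->
  (forall i : nat, Q (miss u (i * S)) <= (expR (- i%:R))%:E) ->
  moment Q alpha u <= (K * expR (alpha * ln S%:R))%:E.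
Proof.
move=> a0; have [k k0 hk] := power_le_expR a0.
pose x : R := expR (- 2^-1).
have x0 : (0 < x)%R by exact: expR_gt0.
have x1 : (x < 1)%R by rewrite -expR0 ltr_expR; lra.
exists (k / (1 - x))%R; first by rewrite divr_gt0 ?subr_gt0.
move=> Q n u S S0 hS.
have S0' : (0 < S%:R :> R)%R by rewrite ltr0n.
(* If W lies between [i * S] and [(i + 1) * S], the [i]-th term alone dominates. *)
pose f (i : nat) (y : Omega A) : \bar R :=
  (expR (alpha * ln (i.+1 * S)%:R))%:E * (\1_(miss u (i * S)) y)%:E.
have f0 i y : 0 <= f i y.
  by rewrite mule_ge0// lee_fin ?expR_ge0// indicE.
have mf i : measurable_fun setT (f i).
  by apply: emeasurable_funM => //; apply/measurable_EFinP; apply: measurable_indic; exact: measurable_miss.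
apply: (@le_trans _ _ (\int[Q]_y \sum_(0 <= i <oo) f i y)).
  apply: ae_ge0_le_integral => //.
  - by move=> y _; exact: expeR_ge0.
  - exact: measurable_hit_expeR.
  - by move=> y _; exact: nneseries_ge0.
  - exact: ge0_emeasurable_sum.
  exists [set y | hit u y = +oo]; split.
  - have := measurable_hit u measurableT (emeasurable_set1 +oo).
    by rewrite setTI.
  - exact: (prob_never_hit hS).
  move=> y /= h; apply: contrapT => hy; apply: h => _.
  have [//|[j hj]] := hit_cases u y.
  pose i := (j %/ S)%N.
  have hi : miss u (i * S) y.
    apply: contrapT => /not_miss_hit; rewrite hj lee_fin ler_nat ltnNge.
    by rewrite leq_trunc_div.
  apply: (@le_trans _ _ (f i y)).
    rewrite /f indicE mem_set// mule1 hj lne_EFin// -EFinM/= lee_fin ler_expR.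
    rewrite ler_wpM2l// ler_ln ?posrE ?ltr0n ?muln_gt0//.
    by rewrite ler_nat; exact: ltn_ceil.
  apply: le_trans (nneseries_lim_ge i.+1 _) => //.
  by rewrite big_nat_recr//= leeDr// sume_ge0.
rewrite integral_nneseries//.
have hf i : \int[Q]_y f i y <= (k * expR (alpha * ln S%:R) * x ^+ i)%:E.
  rewrite ge0_integralZl//; last first.
    by apply/measurable_EFinP; apply: measurable_indic; exact: measurable_miss.
  rewrite integral_indic// ?setIT; last exact: measurable_miss.
  apply: (@le_trans _ _ ((expR (alpha * ln (i.+1 * S)%:R))%:E * (expR (- i%:R))%:E)).
    by apply: lee_wpmul2l; [rewrite lee_fin expR_ge0|exact: hS].
  rewrite -EFinM lee_fin natrM lnM ?posrE// mulrDr expRD.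
  have -> : (x ^+ i = expR (i%:R / 2) * expR (- i%:R))%R.
    by rewrite -expRM_natl -expRD; congr expR; field.
  have h : (expR (alpha * ln i.+1%:R) * expR (- i%:R) <=
      k * expR (i%:R / 2) * expR (- i%:R))%R by rewrite ler_pM2r ?expR_gt0.
  have := ler_wpM2r (expR_ge0 (alpha * ln S%:R)) h.
  by congr (_ <= _)%R; ring.
apply: lime_le; first by apply: is_cvg_nneseries => i _ _; apply: integral_ge0.
apply: nearW => N.
apply: (@le_trans _ _ (\sum_(0 <= i < N) (k * expR (alpha * ln S%:R) * x ^+ i)%:E)).
  by apply: lee_sum => i _.
rewrite sumEFin lee_fin -mulr_sumr [leRHS]mulrAC.
rewrite ler_pM2l ?mulr_gt0 ?expR_gt0// big_mkord.
have := subrX1 x N; have xN : (0 < x ^+ N)%R by rewrite exprn_gt0.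
rewrite -[(1 - x)^-1%R]mul1r ler_pdivlMr ?subr_gt0//; lra.
Qed.

End words.

(** * Averages over the first word *)

Section decoupled.
Context {R : realType} {A : alphabetType}.
Variables (tau : nat -> nat) (C : nat -> R) (P Q : probability (Omega A) R).
Hypothesis tauC : decoupling_sequences tau C.
Hypothesis Qinv : shift_invariant Q.
Hypothesis PQ : admissible tau C P Q.

Let C_ge1 n : (0 < n)%N -> (1 <= C n)%R.
Proof. by case: tauC => h _ _; exact: h. Qed.

Lemma cyl_prob_gt0 n (u : n.-tuple A) :
  (0 < n)%N -> (0 < cyl_prob P u)%R -> (0 < cyl_prob Q u)%R.
Proof.
move=> n0 pu; rewrite lt_neqAle cyl_prob_ge0 andbT; apply/eqP => qu.
case: PQ => /(_ n n0 [set u]) h _ _ _.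
have := h; rewrite !marginalE -qu => /(_ erefl)[] p0.
by rewrite p0 ltxx in pu.
Qed.

Lemma prob_miss_geometric n (u : n.-tuple A) j : (0 < n)%N ->
  Q (miss u (j * (n + tau n))) <= ((1 - cyl_prob Q u / C n) ^+ j)%:E.
Proof.
move=> n0; have C1 := C_ge1 n0.
apply: prob_miss_le => //.
  by rewrite ler_pdivrMr ?mul1r ?(le_trans (cyl_prob_le1 _ _))// (lt_le_trans ltr01).
move=> m v m0; case: PQ => _ _ _ /(_ n m u v n0 m0)[l [lt [xi [_ h]]]].
exists l; split => //; exists xi.
by move: h; rewrite !marginalE -!EFinM lee_fin [(cyl_prob Q u / _)%R]mulrC.
Qed.

Lemma prob_miss_exp n (u : n.-tuple A) j : (0 < n)%N ->
  Q (miss u (j * (n + tau n))) <= (expR (- (j%:R * (cyl_prob Q u / C n))))%:E.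
Proof.
move=> n0; apply: (le_trans (prob_miss_geometric u j n0)).
rewrite lee_fin.
have -> : (- (j%:R * (cyl_prob Q u / C n)) = j%:R * (- (cyl_prob Q u / C n)))%R by rewrite mulrN.
rewrite expRM_natl; apply: lerXn2r; rewrite ?nnegrE ?expR_ge0//.
  have C1 := C_ge1 n0.
  by rewrite subr_ge0 ler_pdivrMr ?mul1r ?(le_trans (cyl_prob_le1 _ _))// (lt_le_trans ltr01).
exact: expR_ge1Dx.
Qed.

(** About [C n / q] trials of length [n + tau n] are needed to make the
    probability of failure smaller than [exp (-1)]. *)
Lemma exists_hit_scale n (u : n.-tuple A) : (0 < n)%N -> (0 < cyl_prob Q u)%R ->
  exists S, [/\ (0 < S)%N,
    forall i : nat, Q (miss u (i * S)) <= (expR (- i%:R))%:E &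
    (S%:R <= 2 * ((n + tau n)%:R * C n) / cyl_prob Q u :> R)%R].
Proof.
move=> n0 q0; have C1 := C_ge1 n0; set q := cyl_prob Q u in q0 *.
have C0 : (0 < C n)%R by exact: lt_le_trans C1.
have q1 : (q <= 1)%R by exact: cyl_prob_le1.
pose c := (q / C n)%R.
have c0 : (0 < c)%R by rewrite divr_gt0.
have c1 : (c <= 1)%R by rewrite ler_pdivrMr// mul1r (le_trans q1).
pose N := (Num.truncn c^-1).+1.
have cN : (c^-1 <= N%:R)%R by rewrite ltW// truncnS_gt.
have cN2 : (N%:R <= 2 * c^-1)%R.
  have : ((Num.truncn c^-1)%:R <= c^-1)%R by rewrite -truncn_ge_nat// invr_ge0 ltW.
  have : (1 <= c^-1)%R by rewrite invf_ge1.
  rewrite /N -natr1; lra.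
exists (N * (n + tau n))%N; split.
- by rewrite muln_gt0/= addn_gt0 n0.
- move=> i; rewrite mulnA; apply: (le_trans (prob_miss_exp u _ n0)).
  rewrite lee_fin ler_expR lerN2 natrM -mulrA ler_peMr//.
  by rewrite -/q -/c -ler_pdivrMr// mul1r.
- have -> : (2 * ((n + tau n)%:R * C n) / q = 2 * c^-1 * (n + tau n)%:R :> R)%R.
    by rewrite /c; field; rewrite !gt_eqF.
  by rewrite natrM ler_wpM2r.
Qed.

Lemma prob_never_hit_admissible n (u : n.-tuple A) : (0 < n)%N ->
  (0 < cyl_prob P u)%R -> Q [set y | @hit R _ _ u y = +oo] = 0.
Proof.
move=> n0 /(cyl_prob_gt0 n0) /(exists_hit_scale n0)[S [_ h _]].
exact: prob_never_hit h.
Qed.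

(** The integral of Q_n(x_1^n)^(- alpha) against [P]. *)
Definition mean_prob_power (alpha : R) n : R :=
  (\sum_(u : n.-tuple A | 0 < cyl_prob P u)
     expR (- alpha * ln (cyl_prob Q u)) * cyl_prob P u)%R.

(** The integral of W_n^alpha against the product measure; see
    [scaled_cgf_waitingE]. *)
Definition mean_waiting_power (alpha : R) n : \bar R :=
  \sum_(u : n.-tuple A) (cyl_prob P u)%:E * moment Q alpha u.

Lemma log_rate_mean_prob_power (alpha : R) n : (0 < n)%N ->
  scaled_cgf_prob P Q alpha n = log_rate (fun n => (mean_prob_power alpha n)%:E) n.
Proof.
move=> n0; rewrite /scaled_cgf_prob /log_rate; congr (_ * lne _).
rewrite -sumEFin; apply: eq_big => [u|u]; rewrite !marginalE ?lte_fin// => pu.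
rewrite poweR_EFin -EFinM /powR gt_eqF// cyl_prob_gt0//.
Qed.

Lemma sum_cyl_prob n : (\sum_(u : n.-tuple A) cyl_prob P u = 1)%R.
Proof.
apply/EFin_inj; rewrite -sumEFin -(probability_setT P).
rewrite (prob_split_word P 0 n measurableT); apply: eq_bigr => u _.
by rewrite setTI -marginalE.
Qed.

Lemma sum_cyl_prob_le1 n : (\sum_(u : n.-tuple A | 0 < cyl_prob P u) cyl_prob P u <= 1)%R.
Proof.
rewrite -(sum_cyl_prob n) big_mkcond/=; apply: ler_sum => u _.
by case: ifP => // _; exact: cyl_prob_ge0.
Qed.

(** Words outside the support of [P] carry weight zero, even where the moment is
    infinite. *)
Lemma mean_waiting_power_le (alpha : R) n (f : n.-tuple A -> R) :
  (forall u, (0 < cyl_prob P u)%R -> moment Q alpha u <= (f u)%:E) ->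
  mean_waiting_power alpha n <= (\sum_(u | (0 < cyl_prob P u)%R) f u * cyl_prob P u)%:E.
Proof.
move=> hf; rewrite -sumEFin /mean_waiting_power [leRHS]big_mkcond/=; apply: lee_sum => u _.
case: ifPn => [pu|].
  by rewrite muleC EFinM lee_pmul2r// hf.
rewrite lt_neqAle cyl_prob_ge0 andbT negbK => /eqP <-.
by rewrite mul0e.
Qed.

Lemma mean_waiting_power_pos (alpha : R) : (0 <= alpha)%R -> exists2 K : R, (0 < K)%R &
  forall n, (0 < n)%N -> mean_waiting_power alpha n <=
    (K * expR (alpha * ln (2 * ((n + tau n)%:R * C n))) * mean_prob_power alpha n)%:E.
Proof.
move=> a0; have [K K0 hK] := @moment_pos_le R A alpha a0.
exists K => // n n0; rewrite /mean_prob_power mulr_sumr.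
have C0 : (0 < C n)%R by exact: lt_le_trans (C_ge1 n0).
have L0 : (0 < (n + tau n)%:R :> R)%R by rewrite ltr0n addn_gt0 n0.
under eq_bigr do rewrite mulrA.
apply: mean_waiting_power_le => u pu.
have qu := cyl_prob_gt0 n0 pu.
have [S [S0 hS SL]] := exists_hit_scale n0 qu.
apply: (le_trans (hK _ _ _ _ S0 hS)); rewrite lee_fin -mulrA ler_pM2l// -expRD ler_expR.
have S0' : (0 < S%:R :> R)%R by rewrite ltr0n.
rewrite mulNr -mulrBr ler_wpM2l// -ln_div ?posrE ?mulr_gt0//.
by rewrite ler_ln// posrE ?divr_gt0 ?mulr_gt0.
Qed.

Lemma mean_waiting_power_neg (theta g : R) m n : (0 < n)%N ->
  (0 <= theta <= 1)%R -> (0 <= g)%R ->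
  mean_waiting_power (- theta) n <=
    (m%:R * expR (theta * g) * mean_prob_power (- theta) n + expR (- (m%:R * g * theta)))%:E.
Proof.
move=> n0 th g0.
apply: (@le_trans _ _ (\sum_(u : n.-tuple A | (0 < cyl_prob P u)%R)
    (m%:R * expR (theta * (g + ln (cyl_prob Q u))) + expR (- (m%:R * g * theta))) * cyl_prob P u)%R%:E).
  apply: mean_waiting_power_le => u pu.
  exact: (moment_neg_le Qinv m th g0 (cyl_prob_gt0 n0 pu)).
rewrite lee_fin; under eq_bigr do rewrite mulrDl mulrDr expRD mulrA.
rewrite big_split/= lerD//.
  by rewrite /mean_prob_power opprK mulr_sumr; apply: ler_sum => u _; rewrite mulrA.
by rewrite -mulr_sumr ler_piMr ?expR_ge0 ?sum_cyl_prob_le1.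
Qed.

Lemma mean_waiting_power_le_exponent (alpha beta : R) n : (alpha <= beta)%R ->
  mean_waiting_power alpha n <= mean_waiting_power beta n.
Proof.
move=> ab; apply: lee_sum => u _; apply: lee_wpmul2l.
  by rewrite lee_fin cyl_prob_ge0.
apply: ge0_le_integral => //.
- by move=> y _; exact: expeR_ge0.
- exact: measurable_hit_expeR.
- exact: measurable_hit_expeR.
- by move=> y _; rewrite lee_expeR lee_wpmul2r// ?lee_fin// lne_ge0_hit.
Qed.

Lemma growth_mean_waiting_power_pos (alpha : R) l : (0 <= alpha)%R ->
  growth_le (fun n => (mean_prob_power alpha n)%:E) l ->
  growth_le (mean_waiting_power alpha) l.
Proof.
move=> a0 hl z /lte_real_between[z1 /andP[lz1]]; rewrite lte_fin => z1z.
have [K K0 hK] := mean_waiting_power_pos a0.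
pose d := ((z - z1) / 2)%R; have d0 : (0 < d)%R by rewrite /d; lra.
pose e := (d / (2 * (alpha + 1)))%R.
have e0 : (0 < e)%R by rewrite divr_gt0// mulr_gt0//; lra.
near=> n.
have n0 : (0 < n)%N by near: n; exists 1%N.
have hz1 : (mean_prob_power alpha n)%:E <= (expR (n%:R * z1))%:E by near: n; exact: hl.
have hKn : (K <= expR (n%:R * d))%R by near: n; exact: near_le_expR.
have hC : ((n + tau n)%:R * C n <= expR (n%:R * e))%R.
  by near: n; exact: (decoupling_constants_subexp tauC).
have h2 : (2 <= expR (n%:R * e))%R by near: n; exact: near_le_expR.
apply: (le_trans (hK n n0)); rewrite lee_fin in hz1 *.
have C0 : (0 < C n)%R by exact: lt_le_trans (C_ge1 n0).
have L0 : (0 < (n + tau n)%:R :> R)%R by rewrite ltr0n addn_gt0 n0.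
have hl2 : (alpha * ln (2 * ((n + tau n)%:R * C n)) <= n%:R * d)%R.
  have h3 : (ln (2 * ((n + tau n)%:R * C n)) <= n%:R * (2 * e))%R.
    rewrite -[leRHS]expRK ler_ln ?posrE ?mulr_gt0 ?expR_gt0//.
    have -> : (n%:R * (2 * e) = n%:R * e + n%:R * e)%R by ring.
    by rewrite expRD ler_pM// mulr_ge0// ltW.
  apply: (le_trans (ler_wpM2l a0 h3)).
  rewrite mulrCA ler_wpM2l// /e.
  have a1 : (0 < alpha + 1)%R by lra.
  have -> : (alpha * (2 * (d / (2 * (alpha + 1)))) = d * (alpha / (alpha + 1)))%R.
    by field; rewrite gt_eqF.
  by apply: ler_piMr; [exact: ltW|rewrite ler_pdivrMr// mul1r; lra].
have -> : (n%:R * z = n%:R * d + n%:R * d + n%:R * z1)%R by rewrite /d; field.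
rewrite !expRD; apply: ler_pM => //.
- by rewrite mulr_ge0 ?expR_ge0// ltW.
- by apply: sumr_ge0 => u _; rewrite mulr_ge0 ?expR_ge0 ?cyl_prob_ge0.
- by apply: ler_pM; rewrite ?expR_ge0 ?ler_expR// ltW.
Unshelve. all: by end_near. Qed.

Lemma growth_mean_waiting_power_neg (theta : R) l : (0 < theta <= 1)%R ->
  growth_le (fun n => (mean_prob_power (- theta) n)%:E) l ->
  growth_le (mean_waiting_power (- theta)) l.
Proof.
move=> /andP[th0 th1] hl z /lte_real_between[z1 /andP[lz1]]; rewrite lte_fin => z1z.
have th : (0 <= theta <= 1)%R by rewrite ltW.
pose d := ((z - z1) / 2)%R; have d0 : (0 < d)%R by rewrite /d; lra.
(* Enough levels for the remainder [exp (- m d theta n)] to be below the target. *)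
pose m := (Num.truncn ((1 - z) / (d * theta))).+1.
have hm : (1 - z <= m%:R * d * theta)%R.
  have dt0 : (0 < d * theta)%R by exact: mulr_gt0.
  have h := ltW (truncnS_gt ((1 - z) / (d * theta))).
  rewrite ler_pdivrMr// in h.
  by rewrite -mulrA.
near=> n.
have n0 : (0 < n)%N by near: n; exists 1%N.
have hz1 : (mean_prob_power (- theta) n)%:E <= (expR (n%:R * z1))%:E by near: n; exact: hl.
have hmn : (2 * m%:R <= expR (n%:R * d))%R by near: n; exact: near_le_expR.
have h2n : (2 <= expR (n%:R * 1) :> R)%R by near: n; exact: near_le_expR.
have g0 : (0 <= n%:R * d)%R by rewrite mulr_ge0// ltW.
apply: (le_trans (mean_waiting_power_neg m n0 th g0)); rewrite lee_fin in hz1 *.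
have E1 : (m%:R * expR (theta * (n%:R * d)) * mean_prob_power (- theta) n <= expR (n%:R * z) / 2)%R.
  apply: (@le_trans _ _ (m%:R * expR (n%:R * d) * expR (n%:R * z1))%R).
    apply: ler_pM => //.
    - by apply: sumr_ge0 => u _; rewrite mulr_ge0 ?expR_ge0 ?cyl_prob_ge0.
    - by rewrite ler_wpM2l// ler_expR ler_piMl.
  have -> : (n%:R * z = n%:R * d + n%:R * d + n%:R * z1)%R by rewrite /d; field.
  rewrite !expRD ler_pdivlMr// mulrAC ler_pM2r ?expR_gt0// mulrAC ler_pM2r ?expR_gt0//.
  by rewrite mulrC.
have E2 : (expR (- (m%:R * (n%:R * d) * theta)) <= expR (n%:R * z) / 2)%R.
  rewrite ler_pdivlMr//.
  apply: (@le_trans _ _ (expR (n%:R * (z - 1)) * expR (n%:R * 1))%R).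
    apply: ler_pM; rewrite ?expR_ge0// ler_expR.
    have -> : (- (m%:R * (n%:R * d) * theta) = n%:R * (- (m%:R * d * theta)))%R by ring.
    by apply: ler_wpM2l => //; lra.
  by rewrite -expRD -mulrDr subrK.
rewrite lee_fin; lra.
Unshelve. all: by end_near. Qed.

End decoupled.

(** * Legendre duality for the waiting rate *)

Section convex_duality.
Context {R : realType}.
Implicit Types (f : R -> \bar R).

Lemma legendre_ge f (alpha s : R) : (alpha * s)%:E - f s <= legendre f alpha.
Proof. by apply: ereal_sup_ubound; exists s. Qed.

Lemma legendre_gtP f (alpha : R) (z : \bar R) : z < legendre f alpha ->
  exists s, z < (alpha * s)%:E - f s.
Proof. by move=> /ereal_sup_gt[_ [s _ <-] h]; exists s. Qed.

Lemma legendre_le f (alpha : R) (z : \bar R) :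
  (forall s, (alpha * s)%:E - f s <= z) -> legendre f alpha <= z.
Proof. by move=> h; apply: ge_ereal_sup => _ [s _ <-]. Qed.

Lemma legendre_lower_semicontinuous f : (forall s, -oo < f s) ->
  lower_semicontinuous (legendre f).
Proof.
move=> f_gtNy x a /legendre_gtP[s]; have := f_gtNy s.
case fs : (f s) => [r| |]// _; rewrite -EFinB lte_fin => ax.
exists [set t : R | a < t * s - r]%R.
  have c : (t * s - r)%R @[t --> x] --> (x * s - r)%R.
    by apply: cvgB; [apply: cvgM; [exact: cvg_id|exact: cvg_cst]|exact: cvg_cst].
  exact: (cvgr_gt _ c).
move=> t /= at_; apply: lt_le_trans (legendre_ge f t s).
by rewrite fs -EFinB lte_fin.
Qed.

Lemma legendre_convex f : (forall s, -oo < f s) -> econvex (legendre f).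
Proof.
move=> f_gtNy s t l /andP[l0 l1]; apply: legendre_le => x; have := f_gtNy x.
case fx : (f x) => [r| |]// _; last by rewrite addeNy leNye.
have hs := legendre_ge f s x; have ht := legendre_ge f t x.
rewrite fx -EFinB in hs; rewrite fx -EFinB in ht.
apply: (@le_trans _ _ (l%:E * (s * x - r)%:E + (1 - l)%:E * (t * x - r)%:E)).
  by rewrite -EFinB -!EFinM -EFinD lee_fin le_eqVlt; apply/orP; left; apply/eqP; ring.
by apply: leeD; apply: lee_wpmul2l => //; rewrite lee_fin// subr_ge0.
Qed.

Lemma fenchel_young f (alpha s : R) : 0 <= f s ->
  (alpha * s)%:E - legendre f alpha <= f s.
Proof.
have := legendre_ge f alpha s.
case: (f s) => [r| |]//; last by move=> _ _; rewrite leey.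
rewrite -EFinB; case: (legendre f alpha) => [x| |]//= h _; last by rewrite leNye.
by rewrite -EFinB; rewrite !lee_fin in h *; lra.
Qed.

End convex_duality.

Section waiting_rate_duality.
Context {R : realType}.
Variables (I q : R -> \bar R).
Hypothesis I_ge0 : forall s, 0 <= I s.
Hypothesis I_neg : forall s, (s < 0)%R -> I s = +oo.
Hypothesis qE : forall alpha, q alpha = legendre I alpha.
Hypothesis IE : forall s, I s = legendre q s.
Hypothesis q0 : q 0%R = 0.

Definition waiting_cgf (alpha : R) : \bar R := maxe (q alpha) (q (-1)%R).

Lemma waiting_rate_ge0 s : 0 <= waiting_rate I s.
Proof.
rewrite /waiting_rate; case: ifP => // _; apply: le_ereal_inf_tmp => _ [r /= sr <-].
by rewrite adde_ge0// lee_fin subr_ge0.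
Qed.

Lemma rate_finite_point : exists r, I r < 1.
Proof.
have : -1 < legendre I 0%R by rewrite -qE q0 lteN10.
move=> /legendre_gtP[r]; rewrite mul0r sub0e => h; exists r.
by rewrite -lteN2.
Qed.

Lemma cgf_gtNy alpha : -oo < q alpha.
Proof.
have [r r1] := rate_finite_point.
rewrite qE; apply: lt_le_trans (legendre_ge I alpha r).
have : I r \is a fin_num by rewrite ge0_fin_numE// (lt_trans r1) ?ltry.
by case: (I r) => // x _; rewrite -EFinB ltNyr.
Qed.

(** Only nonnegative points contribute to the Legendre transform of [I]. *)
Lemma cgf_mono alpha beta : (alpha <= beta)%R -> q alpha <= q beta.
Proof.
move=> ab; rewrite qE; apply: legendre_le => s.
have [s0|s0] := ltP s 0%R; first by rewrite I_neg//= leNye.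
rewrite qE; apply: le_trans (legendre_ge I beta s).
by rewrite leeD2r// lee_fin ler_wpM2r.
Qed.

Lemma cgf_le0 alpha : (alpha <= 0)%R -> q alpha <= 0.
Proof. by move=> /cgf_mono; rewrite q0. Qed.

(** Exchanging the suprema over [s] and [r], the inner maximum of an affine
    function of [s] over the interval from 0 to [r] is attained at an end point:
    [s = r] gives [q alpha] and [s = 0] gives [q (-1)]. *)
Lemma waiting_cgf_duality alpha : waiting_cgf alpha = legendre (waiting_rate I) alpha.
Proof.
apply/eqP; rewrite eq_le; apply/andP; split.
  rewrite /waiting_cgf ge_max !qE; apply/andP; split; apply: legendre_le => s.
    have [s0|s0] := ltP s 0%R; first by rewrite I_neg//= leNye.
    apply: le_trans (legendre_ge _ _ s); rewrite leeD2l// leeN2.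
    rewrite /waiting_rate ltNge s0/=; apply: ge_ereal_inf.
    by exists (I s) => //; exists s => //=; rewrite subrr add0e.
  have [s0|s0] := ltP s 0%R; first by rewrite I_neg//= leNye.
  apply: le_trans (legendre_ge _ _ 0%R).
  rewrite mulr0 sub0e leeNr; apply: (@le_trans _ _ (s%:E + I s)).
    rewrite /waiting_rate ltxx; apply: ge_ereal_inf.
    by exists (s%:E + I s) => //; exists s => //=; rewrite subr0.
  by case: (I s) => [x| |]//; rewrite -!EFinB -EFinN lee_fin; lra.
apply: legendre_le => s; rewrite /waiting_rate; case: ltP => s0; first by rewrite addeNy leNye.
set J := ereal_inf _; have J0 : 0 <= J.
  by have := waiting_rate_ge0 s; rewrite /waiting_rate ltNge s0.
have : -oo < waiting_cgf alpha by rewrite /waiting_cgf lt_max cgf_gtNy.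
case mE : (waiting_cgf alpha) => [m| |]// _; last by rewrite leey.
suff : (alpha * s - m)%:E <= J.
  case: J J0 => [x| |]// _; rewrite ?addeNy ?leNye//.
  by rewrite -EFinB !lee_fin; lra.
apply: le_ereal_inf_tmp => _ [r /= sr <-].
case Ir : (I r) => [x| |]; first last.
- by have := I_ge0 r; rewrite Ir.
- by rewrite addey// leey.
have h1 : (alpha * r - x)%:E <= m%:E.
  by rewrite -mE /waiting_cgf le_max; apply/orP; left; rewrite qE EFinB -Ir legendre_ge.
have h2 : (-1 * r - x)%:E <= m%:E.
  by rewrite -mE /waiting_cgf le_max; apply/orP; right; rewrite qE EFinB -Ir legendre_ge.
rewrite -EFinD !lee_fin in h1 h2 *.
have [a1|a1] := leP 0%R (alpha + 1)%R.
  have := ler_wpM2l a1 sr; lra.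
have : ((alpha + 1) * s <= 0)%R by rewrite nmulr_rle0.
lra.
Qed.

(** The nontrivial inequality at [s >= 0] starts from a line of slope [alpha]
    below [I] that passes above a given [z < waiting_rate I s] at [s]. If
    [alpha < -1], the line of slope -1 with value [z] at [s] lies below the former
    one to the left of [s], and to the right of [s] it lies below [I] by the
    definition of [waiting_rate]. *)
Lemma waiting_rate_duality s : waiting_rate I s = legendre waiting_cgf s.
Proof.
apply/eqP; rewrite eq_le; apply/andP; split; last first.
  apply: legendre_le => alpha; rewrite waiting_cgf_duality mulrC.
  by apply: fenchel_young; exact: waiting_rate_ge0.
have [s0|s0] := ltP s 0%R.
  rewrite /waiting_rate s0 leye_eq; apply/eqP/eqyP => z z0.
  pose alpha := (z / s)%R.
  have a0 : (alpha <= 0)%R by rewrite /alpha pmulr_rle0// invr_le0 ltW.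
  apply: le_trans (legendre_ge _ _ alpha).
  have : waiting_cgf alpha <= 0 by rewrite /waiting_cgf ge_max !cgf_le0// lerN10.
  have -> : (s * alpha = z)%R by rewrite /alpha mulrC divfK// lt_eqF.
  case: (waiting_cgf alpha) => [x| |]//; last by rewrite leey.
  by rewrite -EFinB !lee_fin; lra.
apply: ge_of_real_lower => z zJ.
have JI : waiting_rate I s <= I s.
  rewrite /waiting_rate ltNge s0/=; apply: ge_ereal_inf.
  by exists (I s) => //; exists s => //=; rewrite subrr add0e.
have := lt_le_trans zJ JI; rewrite IE => /legendre_gtP[alpha h].
have := cgf_gtNy alpha; case qa : (q alpha) h => [x| |]// + _.
rewrite -EFinB lte_fin => h.
have [a1|a1] := leP (-1)%R alpha.
  apply: le_trans (legendre_ge _ _ alpha).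
  have -> : waiting_cgf alpha = q alpha by apply/max_idPl; exact: cgf_mono.
  by rewrite qa -EFinB lee_fin ltW// mulrC.
apply: le_trans (legendre_ge _ _ (-1)%R).
have -> : waiting_cgf (-1)%R = q (-1)%R by rewrite /waiting_cgf maxxx.
suff : q (-1)%R <= (- s - z)%:E.
  have := cgf_gtNy (-1)%R; case: (q (-1)%R) => [w| |]// _.
  by rewrite -EFinB !lee_fin; lra.
rewrite qE; apply: legendre_le => r.
case Ir : (I r) => [w| |]; first last.
- by have := I_ge0 r; rewrite Ir.
- by rewrite addeNy leNye.
rewrite -EFinB lee_fin.
have [sr|rs] := leP s r.
  have : waiting_rate I s <= (r - s)%:E + I r.
    by rewrite /waiting_rate ltNge s0/=; apply: ereal_inf_lbound; exists r.
  move=> /(lt_le_trans zJ); rewrite Ir -EFinD lte_fin; lra.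
have h3 : (alpha * r - w)%:E <= x%:E by rewrite -qa qE EFinB -Ir legendre_ge.
rewrite lee_fin in h3.
have : ((s - r) * (alpha + 1) <= 0)%R by rewrite pmulr_rle0 ?subr_gt0//; lra.
lra.
Qed.

Lemma waiting_cgf_gtNy alpha : -oo < waiting_cgf alpha.
Proof. by rewrite /waiting_cgf lt_max cgf_gtNy. Qed.

Lemma waiting_rate_convex : econvex (waiting_rate I).
Proof.
rewrite (funext waiting_rate_duality); apply: legendre_convex; exact: waiting_cgf_gtNy.
Qed.

Lemma waiting_rate_rate_function : rate_function (waiting_rate I).
Proof.
split; first exact: waiting_rate_ge0.
rewrite (funext waiting_rate_duality); apply: legendre_lower_semicontinuous.
exact: waiting_cgf_gtNy.
Qed.

End waiting_rate_duality.

(** * Large deviations of waiting times *)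

Section window.
Context {R : realType} {A : alphabetType}.
Variables (tau : nat -> nat) (C : nat -> R) (P Q : probability (Omega A) R).
Hypothesis tauC : decoupling_sequences tau C.
Hypothesis Qinv : shift_invariant Q.
Hypothesis PQ : admissible tau C P Q.

(** When [q] is close to [exp (- n r)] with [r >= s], the waiting time lies in the
    window around [exp (n s)] with probability about [exp (- n (r - s))]. The event
    W <= [j (n + tau n)] with [j] close to [exp (n s)] has probability at least of
    order [min 1 (exp (n s) q / C n)], while W <= [exp (n (s - eps))] is
    exponentially less likely, by the union bound. *)
Lemma word_hit_window n (u : n.-tuple A) (s r eps delta : R) : (0 < n)%N ->
  (0 <= s <= r)%R -> (0 < delta)%R -> (4 * delta <= eps)%R ->
  (4 * ((n + tau n)%:R * C n) <= expR (n%:R * delta))%R ->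
  (expR (- (n%:R * (r + delta))) < cyl_prob Q u < expR (- (n%:R * (r - delta))))%R ->
  (expR (n%:R * (s - r - 2 * delta)))%:E <=
   Q [set y | (EFin @` `](s - eps)%R, (s + eps)%R[) ((n%:R^-1 : R)%:E * lne (hit u y))].
Proof.
move=> n0 /andP[s0 sr] d0 de hn /andP[qlo qhi].
have n0' : (0 < n%:R :> R)%R by rewrite ltr0n.
have C1 : (1 <= C n)%R by case: tauC => h _ _; exact: h.
have C0 : (0 < C n)%R by exact: lt_le_trans C1.
set q := cyl_prob Q u in qlo qhi.
have q0 : (0 < q)%R by apply: lt_trans qlo; exact: expR_gt0.
set L := (n + tau n)%N in hn.
have L1 : (1 <= L%:R :> R)%R by rewrite ler1n addn_gt0 n0.
pose E := expR (n%:R * s).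
have E1 : (1 <= E)%R by rewrite -[leLHS]expR0 ler_expR mulr_ge0.
pose j := (Num.truncn E).+1.
have Ej : (E <= j%:R)%R by rewrite ltW// truncnS_gt.
have jE : (j%:R <= 2 * E)%R.
  have : ((Num.truncn E)%:R <= E)%R by rewrite -truncn_ge_nat// expR_ge0.
  rewrite /j -natr1; lra.
pose a := Num.truncn (expR (n%:R * (s - eps))).
have aE : (a%:R <= expR (n%:R * (s - eps)))%R by rewrite -truncn_ge_nat// expR_ge0.
set T := [set y | _].
have mT : measurable T.
  have mB : measurable (EFin @` `](s - eps)%R, (s + eps)%R[ : set (\bar R)) by apply: measurable_image_EFin; exact: measurable_itv.
  have := measurable_comp_hit (fun h => (n%:R^-1)%:E * lne h) u measurableT mB.
  by rewrite setTI.
have D0 := expR_gt0 (n%:R * delta)%R; set D := expR (n%:R * delta) in hn D0.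
have LC : (4 * L%:R <= D)%R.
  apply: le_trans hn; rewrite ler_pM2l// ler_peMr//; lra.
have CD : (4 * C n <= D)%R.
  by apply: le_trans hn; rewrite ler_pM2l// ler_peMl//; exact: ltW.
have D4 : (4 <= D)%R by lra.
have De : (D <= expR (n%:R * eps))%R.
  rewrite ler_expR ler_wpM2l//; lra.
have cover : setT `<=` T `|` miss u (j * L) `|` ~` miss u a.
  move=> y _; have [h1|h1] := pselect (miss u (j * L) y); first by left; right.
  have [h2|h2] := pselect (miss u a y); last by right.
  left; left; have h3 := @not_miss_hit R _ _ _ _ _ h1; have h4 := @miss_hit R _ _ _ _ _ h2.
  have [hy|[k hk]] := @hit_cases R _ _ u y; first by move: h3; rewrite hy.
  rewrite hk !lee_fin in h3 h4.
  have k0 : (0 < k.+1%:R :> R)%R by [].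
  rewrite /T/= hk lne_EFin// -EFinM; exists (n%:R^-1 * ln k.+1%:R)%R => //.
  rewrite /= in_itv/= ltr_pdivlMl// ltr_pdivrMl//; apply/andP; split.
    rewrite -[ltLHS]expRK ltr_ln ?posrE ?expR_gt0//.
    by apply: lt_le_trans h4; exact: truncnS_gt.
  rewrite -[ltRHS]expRK ltr_ln ?posrE ?expR_gt0//.
  apply: (le_lt_trans h3); rewrite natrM.
  apply: (@le_lt_trans _ _ (E * (2 * L%:R))%R).
    by rewrite mulrA [(E * 2)%R]mulrC ler_wpM2r.
  rewrite mulrDr expRD ltr_pM2l ?expR_gt0//; lra.
have h1 : 1 <= Q T + Q (miss u (j * L)) + Q (~` miss u a).
  rewrite -(probability_setT Q).
  have mm : measurable (miss u (j * L) : set (Omega A)) by exact: measurable_miss.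
  have mm' : measurable (~` miss u a : set (Omega A)) by apply: measurableC; exact: measurable_miss.
  apply: (@le_trans _ _ (Q (T `|` miss u (j * L) `|` ~` miss u a))).
    by apply: le_measure => //; rewrite inE//; apply: measurableU => //; exact: measurableU.
  apply: (le_trans (measureU2 _ _ _)) => //; first exact: measurableU.
  by rewrite leeD2r// measureU2.
have QTfin : Q T \is a fin_num by rewrite fin_num_measure.
have h2 := prob_miss_exp tauC Qinv PQ u j n0.
have h3 := prob_missC_le Qinv u a.
pose w := (E * q / C n)%R.
have w0 : (0 < w)%R by rewrite divr_gt0// mulr_gt0 ?expR_gt0.
have h4 : (expR (- (j%:R * (q / C n))) <= expR (- w))%R.
  by rewrite ler_expR lerN2 /w -mulrA ler_wpM2r// ltW// divr_gt0.
have h5 : (expR (- w) <= 1 / (1 + w))%R.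
  rewrite expRN div1r lef_pV2 ?posrE ?expR_gt0//; last by lra.
  exact: expR_ge1Dx.
have h6 : (a%:R * q <= w / 4)%R.
  apply: (@le_trans _ _ (expR (n%:R * (s - eps)) * q)%R).
    by rewrite ler_wpM2r// ltW.
  rewrite mulrBr expRD expRN /w ler_pdivlMr// ler_pdivlMr//.
  rewrite -/E -!mulrA ler_pM2l ?expR_gt0// mulrCA; apply: ler_piMr; first exact: ltW.
  rewrite ler_pdivrMl ?expR_gt0// mulr1; lra.
have h7 : (a%:R * q <= 1 / 4)%R.
  apply: (@le_trans _ _ (expR (n%:R * (s - eps)) * q)%R).
    by rewrite ler_wpM2r// ltW.
  apply: (@le_trans _ _ (expR (n%:R * (s - eps)) * expR (- (n%:R * (r - delta))))%R).
    by rewrite ler_wpM2l ?expR_ge0// ltW.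
  rewrite -expRD; apply: (@le_trans _ _ (expR (- (n%:R * delta)))%R).
    rewrite ler_expR -mulrN -mulrDr -mulrN ler_wpM2l//; lra.
  by rewrite expRN div1r lef_pV2 ?posrE.
have h8 : (expR (n%:R * (s - r - 2 * delta)) <= w / 4)%R.
  have -> : (n%:R * (s - r - 2 * delta) = n%:R * s + (- (n%:R * (r + delta))) - n%:R * delta)%R by ring.
  rewrite 2!expRD -/E (expRN (n%:R * delta)) -/D.
  have hE : (E * expR (- (n%:R * (r + delta))) <= E * q)%R.
    by rewrite ler_wpM2l ?expR_ge0// ltW.
  apply: (@le_trans _ _ (E * q / D)%R).
    by rewrite ler_wpM2r// invr_ge0 ltW.
  rewrite /w -!mulrA ler_pM2l ?expR_gt0// ler_pM2l//.
  by rewrite -invfM lef_pV2 ?posrE ?mulr_gt0//; lra.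
have h9 : (expR (n%:R * (s - r - 2 * delta)) <= 1 / 4)%R.
  apply: (@le_trans _ _ (expR (- (n%:R * delta)))%R).
    rewrite ler_expR -[leRHS]mulrN; apply: ler_wpM2l => //; lra.
  by rewrite expRN div1r lef_pV2 ?posrE.
set X := expR (n%:R * (s - r - 2 * delta)) in h8 h9 *.
rewrite -(fineK QTfin) lee_fin.
have : (1 <= fine (Q T) + expR (- (j%:R * (q / C n))) + a%:R * q)%R.
  rewrite -lee_fin !EFinD (fineK QTfin); apply: (le_trans h1).
  by apply: leeD => //; apply: leeD.
(* The success probability is at least [2 * mu], the early part at most [mu]. *)
pose mu := (Num.min w 1 / 4)%R.
have hmu : (1 / (1 + w) <= 1 - 2 * mu)%R.
  rewrite ler_pdivrMr; last by lra.
  by rewrite /mu minEle; case: (leP w 1%R) => w1; nra.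
have hX : (X <= mu)%R by rewrite /mu minEle; case: ifP.
have ha : (a%:R * q <= mu)%R by rewrite /mu minEle; case: ifP.
lra.
Qed.
End window.

Lemma closed_sup_mem {R : realType} (F : set R) :
  closed F -> F !=set0 -> has_ubound F -> F (sup F).
Proof.
by move=> cF F0 uF; have := closure_sup F0 uF; rewrite -((closure_id F).1 cF).
Qed.

Lemma closed_inf_mem {R : realType} (F : set R) :
  closed F -> F !=set0 -> has_lbound F -> F (inf F).
Proof.
move=> cF F0 lF; apply: contrapT => nF.
have [e /= e0 he] : exists2 e : R, (0 < e)%R & ball (inf F) e `<=` ~` F.
  by have /nbhs_ballP := open_nbhs_nbhs (conj (closed_openC cF) nF).
have [x Fx xe] := inf_adherent e0 (conj F0 lF).
apply: (he x) => //; rewrite /ball/= ltr_distlC xe andbT.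
by rewrite (lt_le_trans _ (ge_inf lF Fx))// ltrBlDr ltrDl.
Qed.


Section waiting_ldp.
Context {R : realType} {A : alphabetType}.
Variables (tau : nat -> nat) (C : nat -> R) (P Q : probability (Omega A) R).
Variables (IQ qQ : R -> \bar R).
Hypothesis tauC : decoupling_sequences tau C.
Hypothesis Qinv : shift_invariant Q.
Hypothesis PQ : admissible tau C P Q.
Hypothesis LDP_IQ : LDP P (neg_log_prob Q) IQ.
Hypothesis lim_qQ : forall alpha : R, scaled_cgf_prob P Q alpha @ \oo --> qQ alpha.
Hypothesis qQE : forall alpha : R, qQ alpha = legendre IQ alpha.
Hypothesis IQE : forall s : R, IQ s = legendre qQ s.

Lemma log_rate_mean_prob_power_cvg alpha :
  log_rate (fun n => (mean_prob_power P Q alpha n)%:E) @ \oo --> qQ alpha.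
Proof.
apply: cvg_trans (lim_qQ (alpha := alpha)); apply: near_eq_cvg.
exists 1%N => // n n0; exact: (log_rate_mean_prob_power PQ).
Qed.

Lemma growth_mean_prob_power alpha :
  growth_le (fun n => (mean_prob_power P Q alpha n)%:E) (qQ alpha).
Proof. by apply: cvg_growth_le; exact: log_rate_mean_prob_power_cvg. Qed.

Lemma cgf_prob0 : qQ 0%R = 0.
Proof.
have h := @log_rate_mean_prob_power_cvg 0%R.
apply: (cvg_unique (@ereal_hausdorff R) h).
have p1 n : mean_prob_power P Q 0%R n = 1%R.
  rewrite /mean_prob_power -(sum_cyl_prob P n) [LHS]big_mkcond/=; apply: eq_bigr => u _.
  rewrite oppr0 mul0r expR0 mul1r; case: ifPn => //.
  by rewrite lt_neqAle cyl_prob_ge0 andbT negbK => /eqP.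
rewrite (_ : log_rate _ = cst 0); first exact: cvg_cst.
by apply/funext => n; rewrite /log_rate p1 lne1 mule0.
Qed.

Lemma rate_ge0 s : 0 <= IQ s.
Proof. by case: LDP_IQ => _ [h _] _ _. Qed.

Lemma neg_log_prob_ge0 n x : 0 <= neg_log_prob Q n x.
Proof.
rewrite /neg_log_prob oppe_ge0 mule_ge0_le0// lne_le0.
 apply: probability_le1; exact: (measurable_word_pred 0).
Qed.

(** Probabilities are at most 1, so negative values never occur, and the lower
    bound on the open negative half-line forces the rate to be infinite. *)
Lemma rate_neg s : (s < 0)%R -> IQ s = +oo.
Proof.
move=> s0; apply/eqP; rewrite -leye_eq leNgt; apply/negP => Is.
case: LDP_IQ => _ _ lo _.
have := lo [set x : R | x < 0]%R (@open_lt _ 0%R).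
move=> /(limn_einf_growth_ge (a := fun n => P (neg_log_prob Q n @^-1` (EFin @` [set x : R | x < 0]%R)))).
have [z /andP[z1 z2]] : exists z, -oo < z%:E < - ereal_inf (IQ @` [set x : R | x < 0]%R).
  apply: lte_real_between; rewrite lteNr/=; apply: le_lt_trans Is.
  by apply: ereal_inf_lbound; exists s.
move=> /(_ z z2) [N _ /(_ N (leqnn N))].
rewrite [X in P X](_ : _ = set0).
  by rewrite measure0 lee_fin leNgt expR_gt0.
apply/seteqP; split => // x /= [t t0 tx].
by have := neg_log_prob_ge0 N x; rewrite -tx lee_fin leNgt t0.
Qed.

Lemma prob_first_word n (D : n.-tuple A -> Prop) :
  P [set x | D (word x 0 n)] = (\sum_(u : n.-tuple A | `[<D u>]) cyl_prob P u)%:E.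
Proof.
rewrite (prob_split_word P 0 n); last exact: (measurable_word_pred 0 D).
rewrite -sumEFin [RHS]big_mkcond/=; apply: eq_bigr => u _.
case: asboolP => Du.
  rewrite -marginalE; congr (P _).
  by apply/seteqP; split => [x []//|x /= hx]; split => //=; rewrite hx.
rewrite (_ : _ `&` _ = set0) ?measure0//.
by apply/seteqP; split => // x [/= h hx]; apply: Du; rewrite -hx.
Qed.

Lemma prob_log_waiting_time n (B : set (\bar R)) :
  (P \x Q) (@log_waiting_time R A n @^-1` B) =
  \sum_(u : n.-tuple A) (cyl_prob P u)%:E *
    Q [set y | B ((n%:R^-1 : R)%:E * lne (hit u y))].
Proof.
exact: (prod_word_event P Q (fun u => [set y | B ((n%:R^-1 : R)%:E * lne (hit u y))])).
Qed.

Lemma waiting_chernoff n (B : set (\bar R)) (alpha kappa : R) : (0 < n)%N ->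
  measurable B -> (forall e, B e -> kappa%:E <= alpha%:E * e) ->
  (P \x Q) (@log_waiting_time R A n @^-1` B) <=
    (expR (- (n%:R * kappa)))%:E * mean_waiting_power P Q alpha n.
Proof.
move=> n0 mB hB; rewrite prob_log_waiting_time /mean_waiting_power ge0_sume_distrr.
  apply: lee_sum => u _; rewrite muleCA; apply: lee_wpmul2l.
    by rewrite lee_fin cyl_prob_ge0.
  exact: prob_hit_le_moment.
by move=> u _; rewrite mule_ge0 ?moment_ge0// lee_fin cyl_prob_ge0.
Qed.

(** Below -1 the moment is compared with the one of order -1, since W >= 1. *)
Lemma growth_mean_waiting_power alpha :
  growth_le (mean_waiting_power P Q alpha) (waiting_cgf qQ alpha).
Proof.
have [a0|a0] := leP 0%R alpha.
  apply: growth_leW (growth_mean_waiting_power_pos tauC Qinv PQ a0 (@growth_mean_prob_power _)).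
  by rewrite /waiting_cgf le_max lexx.
have [a1|a1] := leP (-1)%R alpha.
  have h : (0 < - alpha <= 1)%R by lra.
  have := growth_mean_waiting_power_neg Qinv PQ h (@growth_mean_prob_power _).
  rewrite opprK; apply: growth_leW.
  by rewrite /waiting_cgf le_max lexx.
have h : (0 < (1 : R) <= 1)%R by rewrite ltr01 lexx.
have := growth_mean_waiting_power_neg Qinv PQ h (@growth_mean_prob_power _).
move=> /(growth_leW (_ : _ <= waiting_cgf qQ alpha)) h'.
apply: growth_le_near (h' _); last by rewrite /waiting_cgf le_max lexx orbT.
by apply: nearW => n; apply: mean_waiting_power_le_exponent; exact: ltW.
Qed.

(** Multiplies the probability that Q_n(x_1^n) is about [exp (- n r)], known from
    the large deviations of [neg_log_prob], by the conditional estimate of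
    [word_hit_window]. *)
Lemma growth_window (s r eps : R) : (0 <= s <= r)%R -> (0 < eps)%R ->
  growth_ge (fun n => (P \x Q) (@log_waiting_time R A n @^-1`
      (EFin @` `](s - eps)%R, (s + eps)%R[)))
    (- ((r - s)%:E + IQ r)).
Proof.
move=> sr e0 z; case Ir : (IQ r) => [i| |]; first last.
- by have := rate_ge0 r; rewrite Ir.
- by [].
rewrite -EFinD -EFinN lte_fin => hz.
pose eta := (- (r - s + i) - z)%R.
pose delta := (Num.min eps eta / 4)%R.
have eta0 : (0 < eta)%R by rewrite /eta subr_gt0.
have d0 : (0 < delta)%R by rewrite divr_gt0// lt_min e0.
have de : (4 * delta <= eps)%R.
  by rewrite /delta mulrC divfK// ge_min lexx.
have dn : (4 * delta <= eta)%R.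
  by rewrite /delta mulrC divfK// ge_min lexx orbT.
case: LDP_IQ => _ _ lo _.
have := lo [set` `](r - delta)%R, (r + delta)%R[] (interval_open _ _).
move=> /(_ isT isT) /(limn_einf_growth_ge (a := fun n => P (neg_log_prob Q n @^-1` (EFin @` `](r - delta)%R, (r + delta)%R[)))).
move=> /(_ (- i - delta)%R)[|N _ hN].
  rewrite lteNr; apply: (@le_lt_trans _ _ i%:E).
    by rewrite -Ir; apply: ereal_inf_lbound; exists r => //=; rewrite in_itv/= !ltrBlDr; lra.
  by rewrite -EFinN lte_fin; lra.
near=> n.
have n0 : (0 < n)%N by near: n; exists 1%N.
have n0' : (0 < n%:R :> R)%R by rewrite ltr0n.
have nN : (N <= n)%N by near: n; exists N.
have h4 : (4 <= expR (n%:R * (delta / 2)))%R by near: n; apply: near_le_expR; rewrite divr_gt0.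
have hC : ((n + tau n)%:R * C n <= expR (n%:R * (delta / 2)))%R.
  by near: n; apply: (decoupling_constants_subexp tauC); rewrite divr_gt0.
have hn : (4 * ((n + tau n)%:R * C n) <= expR (n%:R * delta))%R.
  have -> : (n%:R * delta = n%:R * (delta / 2) + n%:R * (delta / 2))%R by field.
  rewrite expRD; apply: ler_pM => //; rewrite mulr_ge0//.
  by case: tauC => /(_ n n0) h _ _; exact: le_trans h.
have := hN n nN.
pose D (u : n.-tuple A) := (EFin @` `](r - delta)%R, (r + delta)%R[)
  (- ((n%:R^-1 : R)%:E * lne (marginal Q [set u]))).
rewrite (prob_first_word D) lee_fin => hD.
rewrite prob_log_waiting_time.
apply: (@le_trans _ _ (\sum_(u : n.-tuple A | `[<D u>]) cyl_prob P u * expR (n%:R * (s - r - 2 * delta)))%R%:E).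
  rewrite -mulr_suml lee_fin.
  apply: (@le_trans _ _ (expR (n%:R * (- i - delta)) * expR (n%:R * (s - r - 2 * delta)))%R).
    rewrite -expRD ler_expR -mulrDr ler_wpM2l//; rewrite /eta in dn; lra.
  by rewrite ler_wpM2r// expR_ge0.
rewrite -sumEFin [leLHS]big_mkcond/=; apply: lee_sum => u _.
case: asboolP => [Du|_]; last first.
  by rewrite mule_ge0// lee_fin cyl_prob_ge0.
rewrite EFinM; apply: lee_wpmul2l; first by rewrite lee_fin cyl_prob_ge0.
apply: (word_hit_window tauC Qinv PQ n0 sr d0 de hn).
case: Du => t /=; rewrite in_itv/= marginalE => /andP[t1 t2].
have [q0|q0] := leP (cyl_prob Q u) 0%R.
  rewrite le0_lneNy ?lee_fin// gt0_muleNy// lte_fin invr_gt0//.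
rewrite lne_EFin// -EFinM -EFinN => -[tE].
have qE : cyl_prob Q u = expR (- (n%:R * t)).
  by rewrite tE mulrN opprK mulrA divff ?mul1r ?lnK ?posrE// gt_eqF.
by rewrite qE !ltr_expR !ltrN2 !ltr_pM2l// t1 t2.
Unshelve. all: by end_near. Qed.

Lemma growth_open (O : set R) : open O ->
  growth_ge (fun n => (P \x Q) (@log_waiting_time R A n @^-1` (EFin @` O)))
    (- ereal_inf (waiting_rate IQ @` O)).
Proof.
move=> oO z; rewrite lteNr => /ereal_inf_lt[_ [s Os <-]].
have [s0|s0] := ltP s 0%R; first by rewrite /waiting_rate s0.
rewrite /waiting_rate (ltNge s) s0/= => /ereal_inf_lt[_ [r /= sr <-] hr].
have [e /= e0 he] : exists2 e : R, (0 < e)%R & ball s e `<=` O.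
  by have /nbhs_ballP := open_nbhs_nbhs (conj oO Os).
have srb : (0 <= s <= r)%R by rewrite s0.
apply: (growth_ge_near _ (growth_window srb e0)); last by rewrite lteNr.
apply: nearW => n; apply: le_measure; rewrite ?inE.
- rewrite -[X in measurable X]setTI; apply: log_waiting_time_measurable => //.
  by apply: measurable_image_EFin; exact: measurable_itv.
- rewrite -[X in measurable X]setTI; apply: log_waiting_time_measurable => //.
  by apply: measurable_image_EFin; exact: open_measurable.
move=> w /= [t ts tw]; exists t => //; apply: he.
by rewrite /ball/= ltr_distlC; move: ts; rewrite in_itv/=.
Qed.

Let IW_ge0 := waiting_rate_ge0 rate_ge0.
Let cgf_duality := waiting_cgf_duality rate_ge0 rate_neg qQE cgf_prob0.
Let rate_duality := waiting_rate_duality rate_ge0 rate_neg qQE IQE cgf_prob0.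
Let W_cgf_gtNy := waiting_cgf_gtNy rate_ge0 qQE cgf_prob0.

(** Chernoff's inequality on a small window around [s] bounds the moment from
    below by [exp (n alpha s)] times the probability of the window. *)
Lemma growth_mean_waiting_power_ge alpha :
  growth_ge (mean_waiting_power P Q alpha) (waiting_cgf qQ alpha).
Proof.
move=> z; rewrite cgf_duality => /legendre_gtP[s].
case Is : (waiting_rate IQ s) => [i| |]//; last by have := IW_ge0 s; rewrite Is.
rewrite -EFinB lte_fin => hz.
pose eta := (alpha * s - i - z)%R.
have eta0 : (0 < eta)%R by rewrite subr_gt0.
pose eps := (eta / (2 * (`|alpha| + 1)))%R.
have a0 : (0 <= `|alpha|)%R by [].
have e0 : (0 < eps)%R by rewrite divr_gt0// mulr_gt0//; lra.
have ae : (`|alpha| * eps <= eta / 2)%R.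
  rewrite /eps; have -> : (`|alpha| * (eta / (2 * (`|alpha| + 1))) = (`|alpha| / (`|alpha| + 1)) * (eta / 2))%R.
    by field; rewrite gt_eqF//; lra.
  by apply: ler_piMl; [lra|rewrite ler_pdivrMr ?mul1r; lra].
pose O : set R := [set` `](s - eps)%R, (s + eps)%R[].
have := @growth_open O (interval_open _ _).
move=> /(_ isT isT (- i - eta / 2)%R)[|N _ hN].
  rewrite lteNr; apply: (@le_lt_trans _ _ i%:E).
    by rewrite -Is; apply: ereal_inf_lbound; exists s => //=; rewrite /O/= in_itv/=; lra.
  by rewrite -EFinN lte_fin; lra.
near=> n.
have n0 : (0 < n)%N by near: n; exists 1%N.
have nN : (N <= n)%N by near: n; exists N.
have hO := hN n nN; rewrite /= in hO.
have := @waiting_chernoff n (EFin @` O) alpha (alpha * s - eta / 2)%R n0.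
move=> /(_ (measurable_image_EFin (open_measurable (interval_open _ _)))).
have hB e : (EFin @` O) e -> (alpha * s - eta / 2)%:E <= alpha%:E * e.
  move=> [x]; rewrite /O/= in_itv/= => /andP[x1 x2] <-.
  rewrite -EFinM lee_fin.
  have : (- (alpha * (x - s)) <= `|alpha| * eps)%R.
    rewrite -mulrN; apply: (le_trans (ler_norm _)); rewrite normrM ler_wpM2l//.
    by rewrite ler_norml; lra.
  lra.
move=> /(_ isT isT hB) h; have := le_trans hO h.
case: (mean_waiting_power P Q alpha n) => [M| |]; first last.
- by rewrite gt0_muleNy ?lte_fin ?expR_gt0.
- by move=> _; rewrite leey.
rewrite -EFinM !lee_fin expRN ler_pdivlMl ?expR_gt0// -expRD -mulrDr.
by apply: le_trans; rewrite ler_expR ler_wpM2l//; rewrite /eta; lra.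
Unshelve. all: by end_near. Qed.

Lemma waiting_cgf_cvg alpha :
  scaled_cgf_waiting P Q alpha @ \oo --> waiting_cgf qQ alpha.
Proof.
rewrite scaled_cgf_waitingE; apply: growth_cvg.
- exact: growth_mean_waiting_power.
- exact: growth_mean_waiting_power_ge.
Qed.

(** Chernoff's inequality with the slope [beta] of a line supporting the rate
    near [b]. As the rate is smaller at [t] than at [b], the slope has the sign of
    [b - t]; the condition on [G], that it lies beyond [b] as seen from [t], is
    what makes [beta * s] at least [beta * b] on [G]. *)
Lemma waiting_tail (G : set R) (t b z : R) : measurable G ->
  waiting_rate IQ t < (- z)%:E -> (- z)%:E < waiting_rate IQ b -> t != b ->
  (forall s, G s -> (0 <= (b - t) * (s - b))%R) ->
  exists2 z', (z' < z)%R & \forall n \near \oo,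
    (P \x Q) (@log_waiting_time R A n @^-1` (EFin @` G)) <= (expR (n%:R * z'))%:E.
Proof.
move=> mG ht; rewrite rate_duality => /legendre_gtP[beta].
have := W_cgf_gtNy beta; case bx : (waiting_cgf qQ beta) => [x| |]// _.
rewrite -EFinB lte_fin => hb tb hG.
have h1 : (t * beta - x < - z)%R.
  rewrite -lte_fin; apply: le_lt_trans ht; rewrite rate_duality EFinB -bx.
  exact: legendre_ge.
have h2 : (0 < beta * (b - t))%R by lra.
pose v := ((x + (b * beta + z)) / 2)%R.
exists (v - b * beta)%R; first by rewrite /v; lra.
have vx : waiting_cgf qQ beta < v%:E by rewrite bx lte_fin /v; lra.
have := growth_mean_waiting_power vx; move=> [N _ hN].
near=> n.
have n0 : (0 < n)%N by near: n; exists 1%N.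
have nN : (N <= n)%N by near: n; exists N.
apply: (le_trans (@waiting_chernoff n (EFin @` G) beta (b * beta)%R n0 (measurable_image_EFin mG) _)).
  move=> _ [s Gs <-]; rewrite -EFinM lee_fin.
  have : (0 <= beta * (s - b))%R.
    have := hG s Gs; have [bt|bt|bt] := ltgtP b t.
    - have b0 : (beta < 0)%R by move: h2; rewrite nmulr_lgt0 ?subr_lt0.
      by rewrite !nmulr_rge0 ?subr_lt0.
    - have b0 : (0 < beta)%R by move: h2; rewrite pmulr_lgt0 ?subr_gt0.
      by rewrite !pmulr_rge0 ?subr_gt0.
    - by rewrite bt eqxx in tb.
  lra.
apply: (@le_trans _ _ ((expR (- (n%:R * (b * beta))))%:E * (expR (n%:R * v))%:E)).
  by apply: lee_wpmul2l; rewrite ?lee_fin ?expR_ge0//; exact: hN.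
by rewrite -EFinM -expRD lee_fin ler_expR le_eqVlt; apply/orP; left; apply/eqP; ring.
Unshelve. all: by end_near. Qed.

Lemma measurable_log_waiting_time_preimage n (B : set (\bar R)) : measurable B ->
  measurable (@log_waiting_time R A n @^-1` B).
Proof.
by move=> mB; rewrite -[X in measurable X]setTI; exact: log_waiting_time_measurable.
Qed.

(** A point [t] of rate below the infimum over [F] exists because the rate has
    infimum 0. It splits [F] in two closed halves, each lying beyond its point
    nearest to [t]. *)
Lemma growth_closed (F : set R) : closed F ->
  growth_le (fun n => (P \x Q) (@log_waiting_time R A n @^-1` (EFin @` F)))
    (- ereal_inf (waiting_rate IQ @` F)).
Proof.
move=> cF z; rewrite lteNl -EFinN => hz.
have mF : measurable F by exact: closed_measurable.
have [z0|z0] := leP 0%R z.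
  apply: nearW => n; apply: (@le_trans _ _ 1).
    apply: probability_le1; apply: measurable_log_waiting_time_preimage.
    exact: measurable_image_EFin.
  by rewrite -[leLHS]/(1%R%:E) lee_fin -[leLHS]expR0 ler_expR mulr_ge0.
have hF s : F s -> (- z)%:E < waiting_rate IQ s.
  by move=> Fs; apply: (lt_le_trans hz); apply: ereal_inf_lbound; exists s.
have [t ht] : exists t, waiting_rate IQ t < (- z)%:E.
  have : z%:E < waiting_cgf qQ 0%R.
    by rewrite /waiting_cgf lt_max cgf_prob0 lte_fin z0.
  by rewrite cgf_duality => /legendre_gtP[t]; rewrite mul0r sub0e lteNr => h; exists t.
have tail (G : set R) : closed G -> G `<=` F ->
    (G !=set0 -> exists b, G b /\ forall s, G s -> (0 <= (b - t) * (s - b))%R) ->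
  exists2 z', (z' < z)%R & \forall n \near \oo,
    (P \x Q) (@log_waiting_time R A n @^-1` (EFin @` G)) <= (expR (n%:R * z'))%:E.
  move=> cG GF; have [->|/set0P G0 /(_ G0)[b [Gb hb]]] := eqVneq G set0.
    move=> _; exists (z - 1)%R; first by rewrite gtrBl.
    by apply: nearW => n; rewrite image_set0 preimage_set0 measure0 lee_fin expR_ge0.
  apply: (waiting_tail _ ht (hF _ (GF _ Gb))) => //; first exact: closed_measurable.
  by apply/eqP => tb; have := lt_trans ht (hF _ (GF _ Gb)); rewrite tb ltxx.
have [z1 z1z h1] : exists2 z', (z' < z)%R & \forall n \near \oo,
    (P \x Q) (@log_waiting_time R A n @^-1` (EFin @` (F `&` [set s | t <= s]%R))) <= (expR (n%:R * z'))%:E.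
  have cG : closed (F `&` [set s | t <= s]%R) by apply: closedI => //; exact: closed_ge.
  apply: tail => // G0.
  have lG : has_lbound (F `&` [set s | t <= s]%R) by exists t => s [].
  have Gi := closed_inf_mem cG G0 lG.
  exists (inf (F `&` [set s | t <= s]%R)); split => // s Gs.
  rewrite mulr_ge0// subr_ge0; first by case: Gi.
  exact: ge_inf.
have [z2 z2z h2] : exists2 z', (z' < z)%R & \forall n \near \oo,
    (P \x Q) (@log_waiting_time R A n @^-1` (EFin @` (F `&` [set s | s <= t]%R))) <= (expR (n%:R * z'))%:E.
  have cG : closed (F `&` [set s | s <= t]%R) by apply: closedI => //; exact: closed_le.
  apply: tail => // G0.
  have lG : has_ubound (F `&` [set s | s <= t]%R) by exists t => s [].
  have Gi := closed_sup_mem cG G0 lG.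
  exists (sup (F `&` [set s | s <= t]%R)); split => // s Gs.
  rewrite mulr_le0// subr_le0; first by case: Gi.
  exact: ub_le_sup.
near=> n.
have h12 : (expR (n%:R * z1) + expR (n%:R * z2) <= expR (n%:R * z))%R.
  by near: n; exact: le_expR_twice.
rewrite -lee_fin EFinD in h12; apply: le_trans h12.
apply: (@le_trans _ _ ((P \x Q) (@log_waiting_time R A n @^-1` (EFin @` (F `&` [set s | t <= s]%R)))
  + (P \x Q) (@log_waiting_time R A n @^-1` (EFin @` (F `&` [set s | s <= t]%R))))); last first.
  by apply: leeD; near: n.
have m1 : measurable (@log_waiting_time R A n @^-1` (EFin @` (F `&` [set s | t <= s]%R))).
  apply: measurable_log_waiting_time_preimage; apply: measurable_image_EFin.
  by apply: closed_measurable; apply: closedI => //; exact: closed_ge.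
have m2 : measurable (@log_waiting_time R A n @^-1` (EFin @` (F `&` [set s | s <= t]%R))).
  apply: measurable_log_waiting_time_preimage; apply: measurable_image_EFin.
  by apply: closed_measurable; apply: closedI => //; exact: closed_le.
apply: le_trans (measureU2 _ m1 m2); apply: le_measure; rewrite ?inE.
- by apply: measurable_log_waiting_time_preimage; exact: measurable_image_EFin.
- exact: measurableU.
move=> w /= [s Fs sw]; have [ts|st] := leP t s; first by left; exists s.
by right; exists s => //; split => //; exact: ltW.
Unshelve. all: by end_near. Qed.

Lemma log_waiting_time_fin n : (0 < n)%N ->
  {ae P \x Q, forall w, @log_waiting_time R A n w \is a fin_num}.
Proof.
move=> n0; exists [set xy | (fun u : n.-tuple A => [set y | @hit R A n u y = +oo]) (word xy.1 0 n) xy.2]; split.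
- apply: (@measurable_word_pair A n (fun u => [set y | @hit R A n u y = +oo])) => u.
  have := measurable_hit (R := R) u measurableT (emeasurable_set1 +oo).
  by rewrite setTI.
- rewrite (prod_word_event P Q (fun u : n.-tuple A => [set y | @hit R A n u y = +oo])).
  rewrite big1// => u _.
  have [pu|] := ltP 0%R (cyl_prob P u).
    by rewrite (prob_never_hit_admissible tauC Qinv PQ n0 pu) mule0.
  rewrite le_eqVlt ltNge cyl_prob_ge0 orbF => /eqP ->; rewrite mul0e//.
move=> [x y] /= h; have [//|[k hk]] := @hit_cases R A n (word x 0 n) y.
exfalso; apply: h; rewrite /log_waiting_time/= waiting_timeE hk lne_EFin//.
Qed.

Lemma waiting_LDP : LDP (P \x Q) (@log_waiting_time R A) (waiting_rate IQ).
Proof.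
split.
- by move=> n n0; split; [exact: log_waiting_time_measurable|exact: log_waiting_time_fin].
- exact: (waiting_rate_rate_function rate_ge0 rate_neg qQE IQE cgf_prob0).
- by move=> O oO; exact: growth_ge_limn_einf (growth_open oO).
- by move=> F cF; exact: growth_le_limn_esup (growth_closed cF).
Qed.

(** * The case of equal measures *)

Section same_measure.
Hypothesis QP : forall B : set (Omega A), measurable B -> Q B = P B.

(** When the measures agree, the sum defining q_Q(1) counts the words of positive
    probability, at most the [n]-th power of the size of the alphabet. *)
Lemma waiting_cgf1_lty : waiting_cgf qQ 1%R < +oo.
Proof.
have lnA0 : (0 <= ln #|{: A}|%:R :> R)%R.
  by rewrite ln_ge0// ler1n; apply/card_gt0P; exists point.
have A0 : (0 < #|{: A}|%:R :> R)%R by rewrite ltr0n; apply/card_gt0P; exists point.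
have h1 : qQ 1%R <= (ln #|{: A}|%:R)%:E.
  have [_ <-] := cvg_limn_einf_sup (@log_rate_mean_prob_power_cvg 1%R).
  apply: growth_le_limn_esup => z; rewrite lte_fin => hz.
  apply: nearW => n; rewrite lee_fin.
  apply: (@le_trans _ _ (expR (n%:R * ln #|{: A}|%:R))); last by rewrite ler_expR ler_wpM2l// ltW.
  rewrite expRM_natl lnK ?posrE// -natrX -card_tuple -sum1_card natr_sum /mean_prob_power big_mkcond/=.
  apply: ler_sum => u _; case: ifPn => // pu.
  have -> : cyl_prob Q u = cyl_prob P u.
    by rewrite /cyl_prob /marginal QP//; exact: (measurable_word_pred 0).
  by rewrite mulN1r expRN lnK ?posrE// mulVf ?gt_eqF.
rewrite /waiting_cgf gt_max (le_lt_trans h1) ?ltry//=.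
by rewrite (le_lt_trans (cgf_le0 rate_neg qQE cgf_prob0 _)) ?lerN10 ?ltry.
Qed.

Lemma waiting_rate_good : good_rate_function (waiting_rate IQ).
Proof.
split; first exact: (waiting_rate_rate_function rate_ge0 rate_neg qQE IQE cgf_prob0).
- apply/cvgeyPge => a; have := waiting_cgf1_lty; have := W_cgf_gtNy 1%R.
  case h : (waiting_cgf qQ 1%R) => [x| |]// _ _.
  near=> s; rewrite rate_duality; apply: le_trans (legendre_ge _ _ 1%R).
  rewrite h -EFinB lee_fin mulr1 lerBrDr; near: s; by apply: nbhs_pinfty_ge; rewrite num_real.
- apply/cvgeyPge => a; near=> s; have s0 : (s < 0)%R.
    by near: s; apply: nbhs_ninfty_lt; rewrite num_real.
  by rewrite /waiting_rate s0 leey.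
Unshelve. all: by end_near. Qed.

Lemma waiting_exponentially_tight :
  exponentially_tight (P \x Q) (@log_waiting_time R A).
Proof.
move=> beta; have := waiting_cgf1_lty; have := W_cgf_gtNy 1%R.
case h : (waiting_cgf qQ 1%R) => [x| |]// _ _.
pose M := Num.max 1%R (x + 1 + beta)%R.
have M1 : (x + 1 + beta <= M)%R by rewrite /M le_max lexx orbT.
exists M; split; first by rewrite /M lt_max ltr01.
have hx : waiting_cgf qQ 1%R < (x + 1)%:E by rewrite h lte_fin ltrDl.
have := growth_mean_waiting_power hx; move=> [N _ hN].
near=> n.
have n0 : (0 < n)%N by near: n; exists 1%N.
have nN : (N <= n)%N by near: n; exists N.
have mM : measurable [set e : \bar R | M%:E <= e].
  by rewrite -[X in measurable X]setTI; apply: emeasurable_fun_c_infty.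
apply: (@le_trans _ _ ((P \x Q) (@log_waiting_time R A n @^-1` [set e | M%:E <= e]))).
  apply: le_measure; rewrite ?inE.
  - apply: measurable_log_waiting_time_preimage; apply: measurableC.
    by apply: measurable_image_EFin; exact: measurable_itv.
  - exact: measurable_log_waiting_time_preimage.
  move=> w /= hw; rewrite leNgt; apply/negP => wM; apply: hw.
  have w0 : 0 <= @log_waiting_time R A n w.
    by rewrite /log_waiting_time mule_ge0 ?lee_fin// waiting_timeE lne_ge0_hit.
  case: (log_waiting_time n w) w0 wM => [r| |]//; rewrite lee_fin lte_fin => r0 rM.
  by exists r => //=; rewrite in_itv/=; lra.
have hk (e : \bar R) : M%:E <= e -> M%:E <= 1%:E * e by rewrite mul1e.
apply: (le_trans (@waiting_chernoff n _ 1%R M n0 mM hk)).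
apply: (@le_trans _ _ ((expR (- (n%:R * M)))%:E * (expR (n%:R * (x + 1)))%:E)).
  by apply: lee_wpmul2l; rewrite ?lee_fin ?expR_ge0//; exact: hN.
rewrite -EFinM -expRD lee_fin ler_expR.
have : (n%:R * (x + 1 + beta) <= n%:R * M)%R by rewrite ler_wpM2l.
lra.
Unshelve. all: by end_near. Qed.

End same_measure.

End waiting_ldp.

Theorem theoremA (R : realType) (A : alphabetType)
    (tau : nat -> nat) (C : nat -> R) (P Q : probability (Omega A) R)
    (IQ qQ : R -> \bar R)
    (tauC : decoupling_sequences tau C)
    (Pinv : shift_invariant P) (Qinv : shift_invariant Q)
    (PQ : admissible tau C P Q)
    (* the rate function I_Q and the limit q_Q of the setting *)
    (LDP_IQ : LDP P (neg_log_prob Q) IQ) (convex_IQ : econvex IQ)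
    (lim_qQ : forall alpha : R, scaled_cgf_prob P Q alpha @ \oo --> qQ alpha)
    (qQE : forall alpha : R, qQ alpha = legendre IQ alpha)
    (IQE : forall s : R, IQ s = legendre qQ s) :
  [/\ LDP (P \x Q) log_waiting_time (waiting_rate IQ) /\
        econvex (waiting_rate IQ),
      exists qW : R -> \bar R,
        [/\ forall alpha : R, -oo < qW alpha /\
              scaled_cgf_waiting P Q alpha @ \oo --> qW alpha,
            forall alpha : R, qW alpha = maxe (qQ alpha) (qQ (-1)%R),
            forall alpha : R, qW alpha = legendre (waiting_rate IQ) alpha
          & forall s : R, waiting_rate IQ s = legendre qW s]
    & (forall B : set (Omega A), measurable B -> Q B = P B) ->
        good_rate_function (waiting_rate IQ) /\
        exponentially_tight (P \x Q) log_waiting_time].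
Proof.
have Ige0 := rate_ge0 LDP_IQ.
have Ineg := rate_neg LDP_IQ.
have q0 := cgf_prob0 PQ lim_qQ.
split.
- split; first exact: (waiting_LDP tauC Qinv PQ LDP_IQ lim_qQ qQE IQE).
  exact: (waiting_rate_convex Ige0 Ineg qQE IQE q0).
- exists (waiting_cgf qQ); split => //.
  + move=> alpha; split; first exact: (waiting_cgf_gtNy Ige0 qQE q0).
    exact: (waiting_cgf_cvg tauC Qinv PQ LDP_IQ lim_qQ qQE).
  + exact: (waiting_cgf_duality Ige0 Ineg qQE q0).
  + exact: (waiting_rate_duality Ige0 Ineg qQE IQE q0).
- move=> QP; split.
  + exact: (waiting_rate_good PQ LDP_IQ lim_qQ qQE IQE QP).
  + exact: (waiting_exponentially_tight tauC Qinv PQ LDP_IQ lim_qQ qQE QP).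
Qed.
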